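(* Let $a$ and $b$ be real numbers such that $a \ge -1$, $b \neq 0$ and $\frac{a}{b} \ge -1$. Let $k \ge 2$ be an integer and let $G \in \mathcal{G}_2$ be a graph of order $n$ with minimum degree $\delta \ge 3k+3$. Then $G$ has property $P(k, \delta)$ if one of the following conditions holds: (i) $\lambda_4(G, a) < (a+1)\delta - \frac{9\left(k+\frac{\delta-1}{\delta}\right)}{\delta+1}$; (ii) $b > 0$ and $\lambda_4(G, a, b) < (a+b)\delta - \frac{9b\left(k+\frac{\delta-1}{\delta}\right)}{\delta+1}$; (iii) $b < 0$ and $\lambda_{n-3}(G, a, b) > (a+b)\delta - \frac{9b\left(k+\frac{\delta-1}{\delta}\right)}{\delta+1}$.
   Context: All graphs are finite, undirected and simple. For a graph $G$ of order $n$, let $A(G)$ be its adjacency matrix and $D(G)$ the diagonal matrix of vertex degrees. For real $a,b$, $\lambda_i(G,a)$ and $\lambda_i(G,a,b)$ denote the $i$-th largest eigenvalue (counted with multiplicity) of the matrices $aD(G)+A(G)$ and $aD(G)+bA(G)$, respectively. For disjoint $X,Y\subseteq V(G)$, $e(X,Y)$ is the number of edges of $G$ with one endpoint in $X$ and the other in $Y$. $\kappa'(G)$ is the edge connectivity of $G$. For a positive integer $t$, $\mathcal{G}_t$ is the set of simple graphs $G$ that contain at least $t+1$ non-empty pairwise disjoint proper subsets $V_1,\ldots,V_{t+1}$ of $V(G)$ such that $V(G)\setminus\bigcup_{i=1}^{t+1}V_i\neq\emptyset$ and $\kappa'(G)=e(V_i,V(G)\setminus V_i)$ for every $i=1,\ldots,t+1$.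 For positive integers $k,d$, a graph $G$ of order $n$ has property $P(k,d)$ if: (a) $G$ contains $k$ pairwise edge-disjoint spanning trees; (b) apart from these $k$ edge-disjoint spanning trees (i.e. edge-disjoint from them), there exists another forest $F$ in $G$ with number of edges $|E(F)|>\frac{d-1}{d}(n-1)$; and (c) if $F$ is not a spanning tree of $G$, then $F$ has a component with at least $d$ edges. *)

(* Defs.v *)
From mathcomp Require Import all_boot all_order all_algebra.
From mathcomp Require Import polyrcf reals.

Set Implicit Arguments.
Unset Strict Implicit.
Unset Printing Implicit Defensive.

Import Order.TTheory GRing.Theory Num.Theory.

(* A simple graph is a symmetric irreflexive relation [e] on a finite type [T].
   A spanning subgraph of it is given by its set of edges, each edge being the
   two-element set of its endpoints. *)
Section Graph.
Variable T : finType.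
Implicit Types (e : rel T) (F : {set {set T}}) (X Y : {set T}).

Definition edges e : {set {set T}} := [set [set x; y] | x in T, y in T & e x y].

Definition edges_between e X Y : nat :=
  #|[set [set x; y] | x in X, y in Y & e x y]|.

Definition degree e (x : T) : nat := #|[set y | e x y]|.

(* Degrees are smaller than #|T|, so the neutral element #|T| plays no role
   when T is nonempty. *)
Definition min_degree e : nat := \big[minn/#|T|]_(x : T) degree e x.

Definition adj F : rel T := fun x y => (x != y) && ([set x; y] \in F).

Definition connected F : bool := [forall x, forall y, connect (adj F) x y].

Definition acyclic F : Prop :=
  forall c : seq T, 2 < size c -> ~ ucycle (adj F) c.

Definition forest e F : Prop := F \subset edges e /\ acyclic F.

Definition spanning_tree e F : Prop := forest e F /\ connected F.

Definition component F (x : T) : {set T} := [set y | connect (adj F) x y].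

Definition component_edges F (x : T) : {set {set T}} :=
  [set f in F | f \subset component F x].

(* The least number of edges whose deletion disconnects the graph.  If T has at
   most one vertex there is no such set of edges and the value is 0. *)
Definition edge_connectivity e : nat :=
  #|[arg min_(F < edges e | (F \subset edges e)
                            && ~~ connected (edges e :\: F)) #|F|]|.

Definition in_Gt (t : nat) e : Prop :=
  exists V : 'I_t.+1 -> {set T},
    [/\ forall i, V i != set0 /\ V i \proper [set: T],
        forall i j, i != j -> [disjoint V i & V j],
        ~: (\bigcup_i V i) != set0
      & forall i, edge_connectivity e = edges_between e (V i) (~: V i)].

Definition property_P (k d : nat) e : Prop :=
  exists Ts : 'I_k -> {set {set T}},
    [/\ forall i, spanning_tree e (Ts i),
        forall i j, i != j -> [disjoint Ts i & Ts j]
      & exists F : {set {set T}},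
          [/\ forest e F,
              forall i, [disjoint F & Ts i],
              ((d%:R - 1) / d%:R * (#|T|%:R - 1) < #|F|%:R :> rat)%R
            & ~ spanning_tree e F ->
              exists x, d <= #|component_edges F x|]].

End Graph.

Section Spectrum.
Local Open Scope ring_scope.
Variable R : realType.

(* The real eigenvalues of M in nonincreasing order, each repeated according to
   its algebraic multiplicity. *)
Definition eigenvalues n (M : 'M[R]_n) : seq R :=
  sort >=%R (flatten [seq nseq (mup x (char_poly M)) x
                     | x <- rootsR (char_poly M)]).

(* The i-th largest eigenvalue, with i counted from 1. *)
Definition nth_eigenvalue n (M : 'M[R]_n) (i : nat) : R :=
  (eigenvalues M)`_i.-1.

Variables (T : finType) (e : rel T).

Definition adjacency_mx : 'M[R]_#|T| :=
  \matrix_(i, j) (e (enum_val i) (enum_val j))%:R.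

Definition degree_mx : 'M[R]_#|T| :=
  diag_mx (\row_i (degree e (enum_val i))%:R).

Definition lambda_a (i : nat) (a : R) : R :=
  nth_eigenvalue (a *: degree_mx + adjacency_mx) i.

Definition lambda_ab (i : nat) (a b : R) : R :=
  nth_eigenvalue (a *: degree_mx + b *: adjacency_mx) i.

End Spectrum.

(* Main.v *)
Require Import Defs.
From mathcomp Require Import all_boot all_order all_algebra.
From mathcomp Require Import complex polyrcf reals.
From mathcomp Require Import zify ring lra.

(** Write d for the minimum degree, c = k + (d-1)/d, kappa for the edge
    connectivity and bd X for the number of edges leaving a vertex set X.

    Spectral side.  For a vector constant on each of four disjoint nonempty
    sets and zero elsewhere, the quadratic form of a D + b A equals
    (a+b) sum deg(u) x_u^2 minus b times the Dirichlet energy, and the energy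
    is at most twice the sum of x_j^2 bd X_j.  By the Courant-Fischer principle
    the eigenvalue hypothesis therefore forbids four disjoint nonempty sets
    that are all sparse, meaning 2 bd X / |X| <= 9 c / (d+1)
    ([lambda_ab_ge], [lambda_ab_le]).

    Cut side.  A set with fewer than d boundary edges has more than d vertices,
    so a set with a small boundary is sparse.  Applied to the three minimum
    cuts V_i given by the class G_2 and to their complement W, this gives
    kappa > k, hence kappa > c ([kappa_gt]).  Now let P be a partition into
    p >= 2 blocks.  At most three blocks are sparse; those have more than c
    boundary edges and all the others more than 3 c, so the boundaries of the
    blocks sum to more than 2 c (p-1) unless p = 3.  For p = 3, a violation
    makes all blocks sparse and W a single vertex; uncrossing the blocks with
    the V_i produces four disjoint sparse sets unless the blocks are the V_i up
    to moving that vertex, and then its degree is too large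
    ([three_blocks_absurd], [partition_boundary]).

    Packing side.  The number of edges crossing P thus exceeds c (p-1) for every
    partition P into p >= 2 blocks.  Matroid union for forests is proved by
    edge exchanges ([maximal_packing]): if no forest of a packing can grow
    without another one shrinking, there is an edge set A, contained up to
    connectivity in each of the forests, whose complement is entirely used.
    Used once this yields k disjoint spanning trees; used again, starting from
    these trees and an empty forest, it yields a forest F disjoint from k
    spanning trees with |F| >= n - p + crossing - k (p-1), where p is the number
    of components of A.  Inside each component of A the forest F is connected.
    Either some component has more than d vertices, and F has a component with
    d edges; or all have at most d vertices, hence at least d >= 3k+3 boundary
    edges each, and the count shows that F is a spanning tree
    ([property_P_of_partitions]). *)

Set Implicit Arguments.
Unset Strict Implicit.
Unset Printing Implicit Defensive.
Import Order.TTheory GRing.Theory Num.Theory.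
Local Open Scope ring_scope.

(** * Eigenvalues of real symmetric matrices *)

Section RealSymmetric.
Local Open Scope sesquilinear_scope.
Variables (R : rcfType) (n : nat).
Local Notation C := R[i].
Local Notation toC := (real_complex R).
Implicit Types (M : 'M[R]_n) (P : 'M[C]_n) (r : 'rV[R]_n).

(** The eigenvalues r are real while the change of basis P is complex: only the
    moduli of the coordinates in the eigenbasis enter the estimates. *)
Definition unitary_diagonalization M P r :=
  P \is unitarymx /\ map_mx toC M = P ^t* *m diag_mx (map_mx toC r) *m P.

Lemma symmetric_diagonalization M :
  M^T = M -> exists P r, unitary_diagonalization M P r.
Proof.
move=> symM; set A := map_mx toC M.
have realA : A \is a realmx.
  by apply/mxOverP => i j; rewrite mxE; apply/complex_realP; exists (M i j).
have hermA : A \is hermsymmx.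
  apply: realsym_hermsym => //; apply/is_hermitianmxP.
  rewrite expr0 scale1r map_mx_id //.
  by apply/matrixP => i j; rewrite !mxE -{1}symM mxE.
have /orthomx_spectralP defA := hermitian_normalmx hermA.
have /mxOverP realD := hermitian_spectral_diag_real hermA.
exists (spectralmx A), (map_mx (@complex.Re R) (spectral_diag A)); split.
  exact: spectral_unitarymx.
suff -> : map_mx toC (map_mx (@complex.Re R) (spectral_diag A)) = spectral_diag A.
  by rewrite -invmx_unitary ?spectral_unitarymx.
by apply/matrixP => i j; rewrite !mxE RRe_real.
Qed.

Lemma unitary_diagonalizationN M P r :
  unitary_diagonalization M P r -> unitary_diagonalization (- M) P (- r).
Proof.
move=> [uP defM]; split=> //.
by rewrite !map_mxN defM raddfN /= mulmxN mulNmx.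
Qed.

Lemma char_poly_diagonalization M P r :
  unitary_diagonalization M P r ->
  char_poly M = \prod_i ('X - (r 0 i)%:P).
Proof.
move=> [uP defM]; apply: (@map_poly_inj _ _ toC).
rewrite map_char_poly defM rmorph_prod /=; set D := diag_mx _.
have PtP : P^t* *m P = 1%:M by rewrite -invmx_unitary // mulVmx ?unitarymx_unit.
have -> : char_poly (P^t* *m D *m P) = char_poly D.
  rewrite /char_poly /char_poly_mx !map_mxM /=; set Q := map_mx _ P.
  set Qt := map_mx _ (P^t*); have QtQ : Qt *m Q = 1%:M.
    by rewrite -map_mxM PtP map_mx1.
  have -> : 'X%:M - Qt *m map_mx polyC D *m Q = Qt *m ('X%:M - map_mx polyC D) *m Q.
    by rewrite mulmxBr mulmxBl scalar_mxC -[_ *m Qt *m _]mulmxA QtQ mulmx1.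
  by rewrite !det_mulmx mulrAC -det_mulmx QtQ det1 mul1r.
rewrite char_poly_trig ?diag_mx_is_trig //; apply: eq_bigr => i _.
by rewrite map_polyXsubC !mxE eqxx.
Qed.

End RealSymmetric.

(** A root of a product of linear factors occurs among them as often as its
    multiplicity, so both sequences have the same multiplicities. *)
Lemma perm_eigenvalues (R : realType) n (M : 'M[R]_n) (r : 'rV[R]_n) :
  char_poly M = \prod_i ('X - (r 0 i)%:P) ->
  perm_eq (eigenvalues M) [seq r 0 i | i : 'I_n].
Proof.
move=> defp; set p := char_poly M in defp *.
have p_neq0 : p != 0 by rewrite monic_neq0 ?char_poly_monic.
have mup_p x : mup x p = count_mem x [seq r 0 i | i : 'I_n].
  by rewrite defp -mu_prod_XsubC /= big_map big_enum.
rewrite /eigenvalues -/p perm_sort; apply/allP => x _ /=; rewrite -mup_p.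
have := roots_on_rootsR p_neq0 x; rewrite !inE /= => rootE.
have uniq_s : uniq (rootsR p) by exact: uniq_roots.
apply/eqP; rewrite count_flatten -map_comp.
have [xs|xNs] := boolP (x \in rootsR p).
  rewrite (perm_sumn (perm_map _ (perm_to_rem xs))).
  rewrite /= count_nseq /= eqxx mul1n sumnE big_map big1_seq ?addn0 // => y /=.
  rewrite mem_rem_uniq // inE /= => /andP[yx _].
  by rewrite count_nseq /= (negPf yx).
rewrite mupNroot ?rootE // sumnE big_map big1_seq // => y /= ys.
by rewrite count_nseq /= (_ : y == x = false) //; apply: contraNF xNs => /eqP<-.
Qed.

Section CourantFischer.
Local Open Scope sesquilinear_scope.
Variables (R : rcfType) (n : nat).
Local Notation C := R[i].
Local Notation toC := (real_complex R).
Implicit Types (M : 'M[R]_n) (P : 'M[C]_n) (r : 'rV[R]_n).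

Lemma diagonalized_form M P r (x : 'rV[C]_n) (y := x *m P^t*) :
  unitary_diagonalization M P r ->
  (x *m map_mx toC M *m x^t*) 0 0 = \sum_i toC (r 0 i) * `|y 0 i| ^+ 2.
Proof.
move=> [uP ->]; have -> : x *m (P^t* *m diag_mx (map_mx toC r) *m P) *m x^t* =
    y *m diag_mx (map_mx toC r) *m y^t*.
  by rewrite /y trmx_mul map_mxM /= trmxCK !mulmxA.
rewrite mxE; apply: eq_bigr => i _; rewrite mul_mx_diag !mxE.
by rewrite normCK mulrAC mulrC.
Qed.

Lemma diagonalized_norm P (x : 'rV[C]_n) (y := x *m P^t*) :
  P \is unitarymx -> (x *m x^t*) 0 0 = \sum_i `|y 0 i| ^+ 2.
Proof.
move=> uP; have -> : x *m x^t* = y *m y^t*.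
  rewrite /y trmx_mul map_mxM /= trmxCK mulmxA -[x *m _ *m P]mulmxA.
  by rewrite -invmx_unitary // mulVmx ?unitarymx_unit // mulmx1.
by rewrite mxE; apply: eq_bigr => i _; rewrite !mxE normCK.
Qed.

(** For x = u + i v the cross terms u M v^T and v M u^T cancel because M is
    symmetric.  Lower bounds on the form over real combinations of the rows of
    W thus extend to complex combinations. *)
Lemma complex_form m (W : 'M[R]_(m, n)) M (c : 'rV[C]_m)
    (u := map_mx (@complex.Re R) c *m W) (v := map_mx (@complex.Im R) c *m W)
    (x := c *m map_mx toC W) : M^T = M ->
  (x *m map_mx toC M *m x^t*) 0 0
    = toC ((u *m M *m u^T) 0 0 + (v *m M *m v^T) 0 0).
Proof.
move=> symM; pose U := map_mx toC u; pose V := map_mx toC v.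
have conjR p q (A : 'M[R]_(p, q)) : (map_mx toC A)^t* = map_mx toC A^T.
  by apply/matrixP => i j; rewrite !mxE; apply/CrealP/complex_realP; exists (A j i).
have defx : x = U + 'i *: V.
  rewrite /U /V /u /v !map_mxM scalemxAl -mulmxDl; congr (_ *m _).
  by apply/rowP => j; rewrite !mxE [LHS]complexE.
have defxt : x^t* = U^T - 'i *: V^T.
  rewrite defx linearD linearZ /= map_mxD map_mxZ /= conjCi scaleNr.
  by rewrite -/(U^t*) -/(V^t*) !conjR !map_trmx.
have symVU : (V *m map_mx toC M *m U^T) 0 0 = (U *m map_mx toC M *m V^T) 0 0.
  have -> : V *m map_mx toC M *m U^T = (U *m map_mx toC M *m V^T)^T.
    have symMC : (map_mx toC M)^T = map_mx toC M by rewrite map_trmx symM.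
    by rewrite !trmx_mul trmxK symMC mulmxA.
  by rewrite mxE.
have form (A : 'rV[R]_n) : (map_mx toC A *m map_mx toC M *m (map_mx toC A)^T) 0 0 =
    toC ((A *m M *m A^T) 0 0) by rewrite map_trmx -!map_mxM mxE.
have expand (p q p' q' : 'M[C]_1) : p' 0 0 = q 0 0 ->
    (p + 'i *: p' - 'i *: (q + 'i *: q')) 0 0 = p 0 0 + q' 0 0.
  rewrite !mxE => ->; rewrite mulrDr mulrA mulCii; ring.
rewrite defxt defx mulmxBr -!scalemxAr !mulmxDl -!scalemxAl.
by rewrite expand // !form rmorphD.
Qed.

(** The Courant-Fischer argument: if fewer than m diagonal entries were at least
    t, some nonzero vector of the m-dimensional row space of W would be
    orthogonal to the corresponding eigenvectors, and the form on that vector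
    would be less than t times its squared norm. *)
Lemma count_large_eigenvalues m (W : 'M[R]_(m, n)) M P r (t : R) :
    M^T = M -> unitary_diagonalization M P r -> row_free W ->
    (forall c : 'rV[R]_m, t * (c *m W *m (c *m W)^T) 0 0
       <= (c *m W *m M *m (c *m W)^T) 0 0) ->
  (m <= #|[set i | (t <= r 0 i)%R]|)%N.
Proof.
move=> symM diagM freeW formW; rewrite leqNgt; apply/negP => ltSm.
set S := [set i | t <= r 0 i] in ltSm.
pose WC := map_mx toC W; pose B := WC *m P^t*.
pose BS := colsub (fun i : 'I_#|S| => enum_val i) B.
(* The coordinates along the |S| < m selected eigenvectors have a common zero. *)
have /rowV0Pn[c /sub_kermxP cBS c_neq0] : kermx BS != 0.
  rewrite -mxrank_eq0 mxrank_ker subn_eq0 -ltnNge.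
  exact: leq_ltn_trans (rank_leq_col _) ltSm.
pose x := c *m WC; pose y := x *m P^t*.
have uP : P \is unitarymx by case: diagM.
have ySE i : i \in S -> y 0 i = 0.
  move=> iS; have /rowP/(_ (enum_rank_in iS i)) := cBS.
  rewrite [RHS]mxE => <-; rewrite /y /x -mulmxA -/B !mxE; apply: eq_bigr => j _.
  by congr (_ * _); rewrite [RHS]mxE enum_rankK_in.
have y_neq0 : y != 0.
  apply: contra_neq c_neq0 => y0.
  have /(congr1 (mulmx^~ P)) : y = 0 by [].
  rewrite mul0mx /y -mulmxA -invmx_unitary // mulVmx ?unitarymx_unit // mulmx1.
  by move/eqP; rewrite mulmx_free_eq0 => [/eqP|] //; rewrite row_free_map.
have lower : toC t * (x *m x^t*) 0 0 <= (x *m map_mx toC M *m x^t*) 0 0.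
  rewrite (complex_form _ _ symM); have := complex_form W c (trmx1 R n).
  rewrite map_mx1 !mulmx1 => ->; rewrite -rmorphM lecR mulrDr.
  by apply: lerD; apply: formW.
suff: (x *m map_mx toC M *m x^t*) 0 0 < toC t * (x *m x^t*) 0 0.
  by move=> /(le_lt_trans lower); rewrite ltxx.
rewrite (diagonalized_form _ diagM) (diagonalized_norm _ uP) mulr_sumr -/y.
have /rV0Pn[j yj_neq0] := y_neq0.
rewrite [ltLHS](bigD1 j) //= [ltRHS](bigD1 j) //=; apply: ltr_leD.
  rewrite ltr_pM2r ?exprn_gt0 ?normr_gt0 // ltcR ltNge.
  by apply: contra_neqN yj_neq0 => tj; rewrite ySE // inE.
apply: ler_sum => i _; have [iS|] := boolP (i \in S).
  by rewrite ySE // normr0 expr0n !mulr0.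
by rewrite inE -ltNge => lti; rewrite ler_wpM2r ?exprn_ge0 // lecR ltW.
Qed.

End CourantFischer.

Section SortedCount.
Variable R : realType.
Implicit Types (s : seq R) (t : R).

Lemma nth_sorted_ge s t m : sorted >=%R s -> (0 < m)%N ->
  (m <= count (fun x => (t <= x)%R) s)%N -> t <= s`_m.-1.
Proof.
move=> sorted_s m_gt0 le_m; rewrite leNgt; apply/negP => lt_t.
move: le_m; rewrite -{1}(cat_take_drop m.-1 s) count_cat leqNgt => /negP; apply.
suff -> : count (fun x => t <= x) (drop m.-1 s) = 0%N.
  rewrite addn0; apply: leq_ltn_trans (count_size _ _) _.
  by rewrite (leq_ltn_trans (n := m.-1)) ?ltn_predL // size_take; case: ltnP.
apply/eqP; rewrite -leqn0 leqNgt -has_count -all_predC.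
apply/(all_nthP 0) => i; rewrite size_drop => lti /=; rewrite nth_drop -ltNge.
apply: le_lt_trans lt_t; apply: (sorted_leq_nth _ _ _ sorted_s) => //.
- exact: ge_trans.
- by move=> x /=; exact: lexx.
- by rewrite inE; move: (size s) lti => k; lia.
- by rewrite inE; move: (size s) lti => k; lia.
- exact: leq_addr.
Qed.

Lemma nth_sorted_le s t m : sorted >=%R s -> (0 < m)%N ->
  (m <= count (fun x => (x <= t)%R) s)%N -> s`_(size s - m) <= t.
Proof.
move=> sorted_s m_gt0 le_m; rewrite leNgt; apply/negP => lt_t.
have le_ms : (m <= size s)%N := leq_trans le_m (count_size _ _).
move: le_m; rewrite -{1}(cat_take_drop (size s - m).+1 s) count_cat leqNgt.
move/negP; apply.
suff -> : count (fun x => x <= t) (take (size s - m).+1 s) = 0%N.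
  apply: leq_ltn_trans (count_size _ _) _; rewrite size_drop subnS subKn //.
  by rewrite ltn_predL.
apply/eqP; rewrite -leqn0 leqNgt -has_count -all_predC.
apply/(all_nthP 0) => i lti; have {}lti : (i <= size s - m)%N.
  by rewrite -ltnS (leq_trans lti) // size_take; case: ltnP.
rewrite /= nth_take // -ltNge.
apply: lt_le_trans lt_t _; apply: (sorted_leq_nth _ _ _ sorted_s) => //.
- exact: ge_trans.
- by move=> x /=; exact: lexx.
- by rewrite inE; move: (size s) lti le_ms => k; lia.
- by rewrite inE; move: (size s) lti le_ms => k; lia.
Qed.

End SortedCount.

Lemma card_set_count (T : finType) (p : pred T) :
  #|[set i | p i]| = count p (enum T).
Proof.
rewrite cardsE cardE -size_filter {1}/enum_mem -enumT.
by congr size; apply: eq_filter.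
Qed.

Section EigenvalueBounds.
Variables (R : realType) (n m : nat) (M : 'M[R]_n) (W : 'M[R]_(m, n)) (t : R).
Hypotheses (symM : M^T = M) (freeW : row_free W) (m_gt0 : (0 < m)%N).

Lemma size_eigenvalues : size (eigenvalues M) = n.
Proof.
have [P [r diagM]] := symmetric_diagonalization symM.
rewrite (perm_size (perm_eigenvalues (char_poly_diagonalization diagM))).
by rewrite size_map size_enum_ord.
Qed.

Lemma sorted_eigenvalues : sorted >=%R (eigenvalues M).
Proof. by apply: sort_sorted => x y; exact: ge_total. Qed.

Lemma nth_eigenvalue_ge :
  (forall c : 'rV[R]_m, t * (c *m W *m (c *m W)^T) 0 0
     <= (c *m W *m M *m (c *m W)^T) 0 0) ->
  t <= nth_eigenvalue M m.
Proof.
move=> formW; apply: nth_sorted_ge sorted_eigenvalues m_gt0 _.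
have [P [r diagM]] := symmetric_diagonalization symM.
have /permP-> := perm_eigenvalues (char_poly_diagonalization diagM).
rewrite count_map -card_set_count.
exact: count_large_eigenvalues symM diagM freeW formW.
Qed.

(** The count of large eigenvalues is applied to - M. *)
Lemma nth_eigenvalue_le :
  (forall c : 'rV[R]_m, (c *m W *m M *m (c *m W)^T) 0 0
     <= t * (c *m W *m (c *m W)^T) 0 0) ->
  nth_eigenvalue M (n - m.-1) <= t.
Proof.
move=> formW; rewrite /nth_eigenvalue.
have -> : (n - m.-1).-1 = (size (eigenvalues M) - m)%N.
  by rewrite size_eigenvalues; lia.
apply: nth_sorted_le sorted_eigenvalues m_gt0 _.
have [P [r diagM]] := symmetric_diagonalization symM.
have /permP-> := perm_eigenvalues (char_poly_diagonalization diagM).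
rewrite count_map -card_set_count.
have symN : (- M)^T = - M by rewrite linearN /= symM.
have formN (c : 'rV[R]_m) : - t * (c *m W *m (c *m W)^T) 0 0
    <= (c *m W *m - M *m (c *m W)^T) 0 0.
  by rewrite mulmxN mulNmx mulNr [leRHS]mxE lerN2; exact: formW.
have := count_large_eigenvalues symN (unitary_diagonalizationN diagM) freeW formN.
by congr (_ <= _)%N; apply: eq_card => i; rewrite !inE mxE lerN2.
Qed.

End EigenvalueBounds.

(** * The quadratic form on vectors constant on disjoint sets *)

Section Boundary.
Variables (T : finType) (e : rel T).
Implicit Types (X Y : {set T}).

(** The number of edges leaving X, counted by ordered pairs of endpoints:
    comparisons between boundaries then hold pair by pair. *)
Definition boundary X : nat :=
  (\sum_x \sum_y [&& x \in X, y \notin X & e x y])%N.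

End Boundary.

Lemma sum_enum_val (V : nmodType) (T : finType) (F : T -> V) :
  \sum_(i < #|T|) F (enum_val i) = \sum_u F u.
Proof. by rewrite -(big_enum_val F). Qed.

Section QuotientForm.
Variables (R : realType) (T : finType) (e : rel T) (m : nat).
Variable X : 'I_m -> {set T}.
Hypothesis esym : symmetric e.
Hypothesis Xdisj : forall i j, i != j -> [disjoint X i & X j].
Implicit Types (c : 'rV[R]_m) (a b q : R).

(** The X j being disjoint, the combination c *m indicator_mx takes at u a value
    that depends only on the unique X j containing u, if any. *)
Let cls (u : T) : option 'I_m := [pick j | u \in X j].

Let clsE u j : (u \in X j) = (cls u == Some j).
Proof.
rewrite /cls; case: pickP => [i ui|none]; last by rewrite none.
have [<-|neq_ij] := eqVneq i j; first by rewrite ui !eqxx.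
by rewrite (disjointFr (Xdisj neq_ij) ui) (inj_eq Some_inj) (negPf neq_ij).
Qed.

Definition indicator_mx : 'M[R]_(m, #|T|) :=
  \matrix_(j, i) (enum_val i \in X j)%:R.

Let coef c (o : option 'I_m) : R := if o is Some j then c 0 j else 0.

Let rowE c i : (c *m indicator_mx) 0 i = coef c (cls (enum_val i)).
Proof.
rewrite mxE; case E : (cls (enum_val i)) => [j|] /=; last first.
  by apply: big1 => j _; rewrite mxE clsE E mulr0.
rewrite (bigD1 j) //= mxE clsE E eqxx mulr1 big1 ?addr0 // => k kj.
by rewrite mxE clsE E (inj_eq Some_inj) eq_sym (negPf kj) mulr0.
Qed.

Let sum_cls c (P : T -> R) :
  \sum_u coef c (cls u) ^+ 2 * P u = \sum_j c 0 j ^+ 2 * \sum_(u in X j) P u.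
Proof.
under [RHS]eq_bigr do rewrite mulr_sumr big_mkcond.
rewrite exchange_big; apply: eq_bigr => u _ /=.
case E : (cls u) => [j|] /=; last first.
  by rewrite expr0n mul0r big1 // => j _; rewrite clsE E.
rewrite (bigD1 j) //= clsE E eqxx big1 ?addr0 // => k kj.
by rewrite clsE E (inj_eq Some_inj) eq_sym (negPf kj).
Qed.

Lemma row_free_indicator_mx : (forall j, X j != set0) -> row_free indicator_mx.
Proof.
(* The right inverse evaluates a vector at one chosen point of each X j. *)
move=> Xn0; apply/row_freeP; exists (\matrix_(i, j)
  (if [pick u in X j] is Some u then (enum_rank u == i)%:R else 0)).
apply/matrixP => j k; rewrite !mxE.
under eq_bigr do rewrite !mxE.
case: pickP => [u uk|none]; last first.
  by case/set0Pn: (Xn0 k) => u; rewrite [u \in _]none.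
rewrite (bigD1 (enum_rank u)) //= enum_rankK eqxx mulr1 big1 ?addr0 => [|i iu].
  congr (_%:R); move: uk; rewrite !clsE => /eqP->.
  by rewrite (inj_eq Some_inj) eq_sym.
by rewrite eq_sym (negPf iu) mulr0.
Qed.

Lemma indicator_norm c (x := c *m indicator_mx) :
  (x *m x^T) 0 0 = \sum_j c 0 j ^+ 2 * #|X j|%:R.
Proof.
rewrite mxE; under eq_bigr do rewrite [_^T _ _]mxE !rowE -expr2.
rewrite (sum_enum_val (fun u => coef c (cls u) ^+ 2)) /=.
under eq_bigr do rewrite -[_ ^+ 2]mulr1.
by rewrite sum_cls; apply: eq_bigr => j _; rewrite sumr_const.
Qed.

Lemma degreeE u : degree e u = (\sum_v e u v)%N.
Proof.
rewrite /degree -sum1_card big_mkcond; apply: eq_bigr => v _.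
by rewrite inE; case: e.
Qed.

Lemma form_sumE a b c (f := fun u => coef c (cls u)) (x := c *m indicator_mx) :
  (x *m (a *: degree_mx R e + b *: adjacency_mx R e) *m x^T) 0 0
    = \sum_u \sum_v (e u v)%:R * (a * f u ^+ 2 + b * (f u * f v)).
Proof.
rewrite mxE; under eq_bigr => j _.
  rewrite [_^T _ _]mxE [in X in X * _]mxE rowE mulr_suml.
  under eq_bigr => i _ do rewrite rowE !mxE.
  over.
rewrite exchange_big /= -[RHS]sum_enum_val.
apply: eq_bigr => i _; rewrite -/(f _).
under eq_bigr do rewrite -/(f _) mulrDr mulrDl.
rewrite big_split /= (bigD1 i) //= eqxx mulr1n.
rewrite [X in _ + X + _]big1 ?addr0; last first.
  by move=> j ji; rewrite eq_sym (negPf ji) mulr0n !(mulr0, mul0r).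
under [RHS]eq_bigr do rewrite mulrDr; rewrite big_split /=; congr (_ + _).
  rewrite -mulr_suml -natr_sum -degreeE; ring.
rewrite (sum_enum_val (fun v => f (enum_val i) * (b * (e (enum_val i) v)%:R) * f v)) /=.
by apply: eq_bigr => v _; ring.
Qed.

(** Substitute 2 f(u) f(v) = f(u)^2 + f(v)^2 - (f(u) - f(v))^2 and sum over the
    symmetric adjacency relation. *)
Lemma form_dirichletE a b c (f := fun u => coef c (cls u))
    (x := c *m indicator_mx) :
  (x *m (a *: degree_mx R e + b *: adjacency_mx R e) *m x^T) 0 0
    = (a + b) * (\sum_u (degree e u)%:R * f u ^+ 2)
      - b / 2 * \sum_u \sum_v (e u v)%:R * (f u - f v) ^+ 2.
Proof.
rewrite form_sumE -/f.
have degE : \sum_u (degree e u)%:R * f u ^+ 2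
    = \sum_u \sum_v (e u v)%:R * f u ^+ 2.
  by apply: eq_bigr => u _; rewrite degreeE natr_sum mulr_suml.
have swap : \sum_u \sum_v (e u v)%:R * f v ^+ 2
    = \sum_u \sum_v (e u v)%:R * f u ^+ 2.
  rewrite exchange_big; apply: eq_bigr => u _; apply: eq_bigr => v _.
  by rewrite esym.
have -> : \sum_u \sum_v (e u v)%:R * (f u - f v) ^+ 2
   = 2 * \sum_u \sum_v (e u v)%:R * f u ^+ 2
     - 2 * \sum_u \sum_v (e u v)%:R * (f u * f v).
  rewrite (_ : 2 = 1 + 1) // mulrDl !mul1r -{2}swap -big_split /= mulr_sumr -sumrB.
  apply: eq_bigr => u _; rewrite -big_split mulr_sumr -sumrB /=.
  by apply: eq_bigr => v _; ring.
rewrite degE; have -> : \sum_u \sum_v (e u v)%:R * (a * f u ^+ 2 + b * (f u * f v))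
   = a * \sum_u \sum_v (e u v)%:R * f u ^+ 2
     + b * \sum_u \sum_v (e u v)%:R * (f u * f v).
  rewrite !mulr_sumr -big_split; apply: eq_bigr => u _ /=.
  by rewrite !mulr_sumr -big_split; apply: eq_bigr => v _ /=; ring.
by field.
Qed.

(** Only edges leaving some X j contribute, and such an edge contributes at most
    2 (f(u)^2 + f(v)^2); ordered pairs count every edge twice, whence 4. *)
Lemma dirichlet_le_boundary c (f := fun u => coef c (cls u)) :
  \sum_u \sum_v (e u v)%:R * (f u - f v) ^+ 2
    <= 4 * \sum_j c 0 j ^+ 2 * (boundary e (X j))%:R.
Proof.
pose cut u v : R := (e u v)%:R * (f u ^+ 2 * (cls u != cls v)%:R).
have cutE : \sum_u \sum_v cut u v = \sum_j c 0 j ^+ 2 * (boundary e (X j))%:R.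
  transitivity (\sum_u f u ^+ 2 * \sum_v ((cls u != cls v) && e u v)%:R).
    apply: eq_bigr => u _; rewrite mulr_sumr; apply: eq_bigr => v _.
    by rewrite /cut mulrCA -natrM mulnb andbC.
  rewrite sum_cls; apply: eq_bigr => j _; congr (_ * _).
  rewrite /boundary natr_sum [LHS]big_mkcond; apply: eq_bigr => u _ /=.
  rewrite natr_sum; case: ifP => [uj|_]; last by rewrite big1.
  apply: eq_bigr => v _; move: uj; rewrite !clsE => /eqP->.
  by rewrite eq_sym.
have swap : \sum_u \sum_v cut v u = \sum_u \sum_v cut u v by rewrite exchange_big.
rewrite -cutE (_ : 4 = 2 + 2); last by ring.
rewrite mulrDl -{2}swap -mulrDr -big_split /= mulr_sumr.
apply: ler_sum => u _; rewrite -big_split mulr_sumr /=.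
apply: ler_sum => v _; rewrite /cut esym [cls v == _]eq_sym -mulrDr [leRHS]mulrCA.
apply: ler_wpM2l => //; rewrite /f.
have [->|_] := eqVneq (cls u) (cls v).
  by rewrite subrr expr0n /= !mulr0 addr0 mulr0.
rewrite !mulr1; have := sqr_ge0 (coef c (cls u) + coef c (cls v)); nra.
Qed.

(** The sign conditions let the degrees be replaced by their lower bound d and
    the Dirichlet energy by its upper bound. *)
Lemma form_ge a b q (d : nat) c (x := c *m indicator_mx) :
  0 <= a + b -> 0 <= b -> (forall u, (d <= degree e u)%N) ->
  (forall j, 2 * (boundary e (X j))%:R <= q * #|X j|%:R) ->
  ((a + b) * d%:R - b * q) * (x *m x^T) 0 0
    <= (x *m (a *: degree_mx R e + b *: adjacency_mx R e) *m x^T) 0 0.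
Proof.
move=> ab_ge0 b_ge0 le_d le_q; rewrite form_dirichletE mulrBl.
apply: lerB.
  rewrite -mulrA; apply: ler_wpM2l => //; rewrite mxE mulr_sumr.
  under eq_bigr do rewrite [_^T _ _]mxE !rowE -expr2.
  rewrite (sum_enum_val (fun u => d%:R * coef c (cls u) ^+ 2)).
  apply: ler_sum => u _; apply: ler_wpM2r; first exact: sqr_ge0.
  by rewrite ler_nat.
apply: le_trans (_ : b / 2 * (4 * \sum_j c 0 j ^+ 2 * (boundary e (X j))%:R) <= _).
  by apply: ler_wpM2l; [rewrite divr_ge0 | exact: dirichlet_le_boundary].
rewrite (_ : b / 2 * _ = b * (2 * \sum_j c 0 j ^+ 2 * (boundary e (X j))%:R));
  last by field.
rewrite -mulrA; apply: ler_wpM2l => //; rewrite indicator_norm !mulr_sumr.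
apply: ler_sum => j _; rewrite mulrCA [leRHS]mulrCA.
by apply: ler_wpM2l; rewrite ?sqr_ge0.
Qed.

End QuotientForm.

Section EigenvalueAlternative.
Variables (R : realType) (T : finType) (e : rel T) (m d : nat).
Variables (X : 'I_m -> {set T}) (a b q : R).
Hypotheses (esym : symmetric e) (m_gt0 : (0 < m)%N).
Hypothesis Xdisj : forall i j, i != j -> [disjoint X i & X j].
Hypothesis Xn0 : forall j, X j != set0.
Hypothesis le_d : forall u, (d <= degree e u)%N.
Hypothesis le_q : forall j, 2 * (boundary e (X j))%:R <= q * #|X j|%:R.

Lemma trmx_graph_mx (a' b' : R) (M := a' *: degree_mx R e + b' *: adjacency_mx R e) :
  M^T = M.
Proof.
rewrite /M linearD !linearZ /= tr_diag_mx; congr (_ + _ *: _).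
by apply/matrixP => i j; rewrite !mxE esym.
Qed.

Lemma lambda_ab_ge : 0 <= a + b -> 0 <= b ->
  (a + b) * d%:R - b * q <= lambda_ab e m a b.
Proof.
move=> ab_ge0 b_ge0; apply: nth_eigenvalue_ge (trmx_graph_mx a b) _ m_gt0 _.
  exact: row_free_indicator_mx Xdisj Xn0.
by move=> c; apply: form_ge.
Qed.

(** The matrix is the opposite of the one with coefficients - a and - b, whose
    form is bounded below. *)
Lemma lambda_ab_le : a + b <= 0 -> b <= 0 ->
  lambda_ab e (#|T| - m.-1) a b <= (a + b) * d%:R - b * q.
Proof.
move=> ab_le0 b_le0; apply: nth_eigenvalue_le (trmx_graph_mx a b) _ m_gt0 _.
  exact: row_free_indicator_mx Xdisj Xn0.
move=> c; set x := c *m _; rewrite -lerN2.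
have -> : - (((a + b) * d%:R - b * q) * (x *m x^T) 0 0)
    = ((- a - b) * d%:R - (- b) * q) * (x *m x^T) 0 0 by ring.
have -> : - (x *m (a *: degree_mx R e + b *: adjacency_mx R e) *m x^T) 0 0
    = (x *m (- a *: degree_mx R e + (- b) *: adjacency_mx R e) *m x^T) 0 0.
  by rewrite !scaleNr -opprD mulmxN mulNmx [RHS]mxE.
by apply: form_ge => //; rewrite -?opprD oppr_ge0.
Qed.

End EigenvalueAlternative.

Local Open Scope nat_scope.

(** * Edge boundaries *)

Lemma eq_set2 (T : finType) (x y u v : T) :
  [set x; y] = [set u; v] -> x = u /\ y = v \/ x = v /\ y = u.
Proof.
move=> eqs; have := set21 x y; have := set22 x y; rewrite eqs !inE.
have := set21 u v; have := set22 u v; rewrite -eqs !inE.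
by do 4 (case/orP => /eqP ?); subst; tauto.
Qed.

Section BoundaryTheory.
Variables (T : finType) (e : rel T).
Hypothesis esym : symmetric e.
Implicit Types (X Y : {set T}).

Lemma edges_between_boundary X : edges_between e X (~: X) = boundary e X.
Proof.
pose D := [set p : T * T | [&& p.1 \in X, p.2 \notin X & e p.1 p.2]].
rewrite /edges_between /boundary.
have -> : [set [set x; y] | x in X, y in ~: X & e x y]
    = (fun p : T * T => [set p.1; p.2]) @: D.
  apply/setP => f; apply/imset2P/imsetP => [[x y xX]|[[x y]]].
    by rewrite !inE => /andP[yX xy] ->; exists (x, y); rewrite // inE /= xX yX.
  by rewrite inE => /and3P[/= xX yX xy] ->; exists x y; rewrite // !inE yX.
rewrite card_in_imset => [|[x y] [u v]]; last first.
  rewrite !inE /= => /and3P[xX yX _] /and3P[uX vX _] /eq_set2[[-> ->] //|[xv _]].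
  by rewrite -xv xX in vX.
rewrite pair_big /= -sum1_card big_mkcond /=; apply: eq_bigr => -[x y] _.
by rewrite inE /=; case: ifP.
Qed.

Lemma boundaryC X : boundary e (~: X) = boundary e X.
Proof.
rewrite /boundary exchange_big; apply: eq_bigr => x _; apply: eq_bigr => y _.
by rewrite !inE negbK esym andbCA.
Qed.

Lemma boundary_submod X Y :
  boundary e (X :&: Y) + boundary e (X :|: Y) <= boundary e X + boundary e Y.
Proof.
rewrite /boundary -!big_split; apply: leq_sum => x _; rewrite -!big_split.
apply: leq_sum => y _; rewrite !inE.
by case: (x \in X); case: (x \in Y); case: (y \in X); case: (y \in Y); case: e.
Qed.

Lemma boundary_setU X Y : boundary e (X :|: Y) <= boundary e X + boundary e Y.
Proof. exact: leq_trans (leq_addl _ _) (boundary_submod X Y). Qed.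

Lemma boundary_setD X Y : boundary e (X :\: Y) <= boundary e X + boundary e Y.
Proof.
rewrite setDE -[boundary e Y]boundaryC.
exact: leq_trans (leq_addr _ _) (boundary_submod X (~: Y)).
Qed.

Lemma boundary_bigcup (I : finType) (V : I -> {set T}) :
  boundary e (\bigcup_i V i) <= \sum_i boundary e (V i).
Proof.
elim/big_rec2: _ => [|i n X _ le_n].
  by rewrite /boundary !big1 // => x _; rewrite big1 // => y _; rewrite inE.
by apply: leq_trans (boundary_setU _ _) _; rewrite leq_add2l.
Qed.

(** A vertex of X has at most |X| - 1 neighbours inside X. *)
Lemma boundary_degree (d : nat) X : irreflexive e ->
  (forall x, d <= degree e x) -> #|X| * d <= boundary e X + #|X| * #|X|.-1.
Proof.
move=> eirr le_d; rewrite -!sum_nat_const /boundary.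
rewrite [X in _ <= X + _](bigID (mem X)) /= [X in _ + X + _]big1 ?addn0; last first.
  by move=> x /negPf xX; rewrite big1 // => y _; rewrite xX.
rewrite -big_split; apply: leq_sum => x xX /=; apply: leq_trans (le_d x) _.
rewrite /degree -sum1_card big_mkcond /= (bigID (mem X)) /= addnC.
apply: leq_add.
  rewrite [leqRHS](bigID (mem X)) /= addnC; apply: leq_trans (leq_addr _ _).
  by apply: leq_sum => y yX; rewrite inE xX yX /=; case: e.
rewrite (cardsD1 x) xX add1n /= -sum1_card -big_mkcondr /=.
rewrite sum1_card sum1_card; apply: subset_leq_card; apply/subsetP => y.
rewrite !inE => /andP[yX xy]; rewrite yX andbT.
by apply: contraTneq xy => ->; rewrite inE eirr.
Qed.

(** The preceding bound |X| (d + 1 - |X|) is concave in |X| and equals d at both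
    ends of the range 1, ..., d. *)
Lemma boundary_small (d : nat) X : irreflexive e ->
  (forall x, d <= degree e x) -> X != set0 -> #|X| <= d -> d <= boundary e X.
Proof.
move=> eirr le_d; rewrite -card_gt0 => X_gt0 leXd.
by have := boundary_degree X eirr le_d; nia.
Qed.

Lemma adj_sym (F : {set {set T}}) : symmetric (adj F).
Proof. by move=> x y; rewrite /adj eq_sym setUC. Qed.

Lemma adj_connect_sym (F : {set {set T}}) : connect_sym (adj F).
Proof. exact/sym_connect_sym/adj_sym. Qed.

(** Deleting the edges that leave X separates X from its complement. *)
Lemma edge_connectivity_le X : X != set0 -> X != setT ->
  edge_connectivity e <= boundary e X.
Proof.
move=> /set0Pn[x xX]; rewrite -subTset => /subsetPn[y _ yX].
rewrite -edges_between_boundary /edges_between.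
set F := [set [set u; v] | u in X, v in ~: X & e u v].
have FE : F \subset edges e.
  apply/subsetP => f /imset2P[u v uX]; rewrite !inE => /andP[vX uv] ->.
  by apply/imset2P; exists u v; rewrite ?inE.
have cut : ~~ connected (edges e :\: F).
  apply/negP => /forallP/(_ x)/forallP/(_ y).
  have /closed_connect clX : closed (adj (edges e :\: F)) (mem X).
    apply: (intro_closed (adj_connect_sym _)) => u v /andP[_].
    rewrite inE => /andP[uvF /imset2P[u' v' _]]; rewrite inE => /andP[_ uv'] uvE uX.
    apply: contraR uvF => vX.
    have uv : e u v.
      by case: (eq_set2 uvE) => -[-> ->]; rewrite // esym.
    by apply/imset2P; exists u v; rewrite ?inE ?vX.
  by move/clX; rewrite /= xX (negPf yX).
rewrite /edge_connectivity; case: arg_minnP => [|A _]; last first.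
  by apply; rewrite FE.
rewrite subxx setDv /=; apply: contra cut => /forallP con.
apply/forallP => u; apply/forallP => v; have /forallP/(_ v) := con u.
apply: connect_sub => s t st; apply: connect1; case/andP: st => _.
by rewrite inE.
Qed.

End BoundaryTheory.

(** * Boundaries of the blocks of a partition *)

Section Partitions.
Variables (T : finType) (e : rel T) (k d kappa : nat) (V : 'I_3 -> {set T}).
Hypotheses (esym : symmetric e) (eirr : irreflexive e).
Hypothesis le_d : forall x, d <= degree e x.
Hypothesis le_kappa : forall X, X != set0 -> X != setT -> kappa <= boundary e X.
Hypothesis Vn0 : forall i, V i != set0.
Hypothesis Vdisj : forall i j, i != j -> [disjoint V i & V j].
Hypothesis Vcover : ~: (\bigcup_i V i) != set0.
Hypothesis Vkappa : forall i, boundary e (V i) = kappa.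
Hypotheses (k_ge2 : 2 <= k) (d_ge : 3 * k + 3 <= d).
Implicit Types (X Y U : {set T}) (P Q : {set {set T}}).

(** C is d times k + (d-1)/d; multiplying by d keeps all inequalities in nat. *)
Let C := k * d + d.-1.
Let bd X := boundary e X.

(** This is 2 bd X / |X| <= 9 c / (d+1) with c = C / d: on combinations of the
    indicators of disjoint sets with this property, the form reaches the
    threshold of the eigenvalue hypothesis. *)
Definition sparse X : bool := 2 * d * d.+1 * bd X <= 9 * C * #|X|.

Hypothesis few_sparse : forall X : 'I_4 -> {set T}, (forall i, X i != set0) ->
  (forall i j, i != j -> [disjoint X i & X j]) -> exists i, ~~ sparse (X i).

Let CE : C.+1 = (k + 1) * d.
Proof. rewrite /C; nia. Qed.

Let dense_small X : X != set0 -> #|X| <= d -> d <= bd X.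
Proof. exact: boundary_small. Qed.

(** A boundary of fewer than d edges forces more than d vertices, which turns a
    bound on the boundary into a bound on its ratio to |X|. *)
Lemma sparse_of_boundary X :
  X != set0 -> bd X < d -> 2 * d * bd X <= 9 * C -> sparse X.
Proof.
move=> Xn0 ltXd leXC; have ltdX : d < #|X|.
  by rewrite ltnNge; apply: contraL ltXd => /dense_small; rewrite -leqNgt; apply.
by rewrite /sparse -mulnA [d.+1 * _]mulnC mulnA leq_mul.
Qed.

Lemma sparse_low X : X != set0 -> d * bd X <= 2 * C -> sparse X.
Proof.
move=> Xn0 leXC; apply: sparse_of_boundary => //; last by nia.
have : d * bd X < d * (2 * (k + 1)) by nia.
by rewrite ltn_mul2l => /andP[_]; lia.
Qed.

Lemma boundary_not_sparse X : X != set0 -> ~~ sparse X -> 3 * C < d * bd X.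
Proof.
move=> Xn0; apply: contraR; rewrite -leqNgt => le3C.
apply: sparse_of_boundary => //; last by nia.
have : d * bd X < d * (3 * (k + 1)) by nia.
by rewrite ltn_mul2l => /andP[_]; lia.
Qed.

(** The hypothesis on families, in the form used with explicitly named sets. *)
Lemma four_sparse A B X Y : [/\ A != set0, B != set0, X != set0 & Y != set0] ->
  [/\ [disjoint A & B], [disjoint A & X], [disjoint A & Y],
      [disjoint B & X] & [disjoint B & Y] /\ [disjoint X & Y]] ->
  [/\ sparse A, sparse B, sparse X & sparse Y] -> False.
Proof.
move=> [A0 B0 X0 Y0] [AB AX AY BX [BY XY]] [sA sB sX sY].
pose F (i : 'I_4) := nth set0 [:: A; B; X; Y] i.
have [||i] := few_sparse (X := F).
- by case=> -[|[|[|[|]]]].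
- by case=> -[|[|[|[|]]]] // ? [[|[|[|[|]]]] ?] //= _; rewrite // disjoint_sym.
- by case: i => -[|[|[|[|]]]] // ?; rewrite /F /= ?sA ?sB ?sX ?sY.
Qed.

Lemma card_sparse_le P : trivIset P -> set0 \notin P ->
  #|[set X in P | sparse X]| <= 3.
Proof.
move=> /trivIsetP trivP P0; set Q := [set X in P | sparse X].
rewrite leqNgt; apply/negP => Q4.
pose F (i : 'I_4) := enum_val (widen_ord Q4 i).
have FQ i : F i \in Q by exact: enum_valP.
have [||i] := few_sparse (X := F).
- by move=> i; apply: contraNneq P0 => <-; have := FQ i; rewrite inE => /andP[].
- have FP i : F i \in P by have := FQ i; rewrite inE => /andP[].
  move=> i j ij; apply: trivP; rewrite ?FP //.
  by apply: contra_neq ij => /enum_val_inj [] /val_inj.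
- by have := FQ i; rewrite inE => /andP[_ ->].
Qed.

Let W := ~: (\bigcup_i V i).

Let boundaryW : bd W <= 3 * kappa.
Proof.
rewrite /bd /W boundaryC //; apply: leq_trans (boundary_bigcup e V) _.
by under eq_bigr do rewrite Vkappa; rewrite sum_nat_const card_ord.
Qed.

Let VW i : [disjoint V i & W].
Proof.
rewrite -setI_eq0; apply/eqP/setP => x; rewrite !inE.
by apply: contraPF (erefl true) => /andP[xi /negP[]]; apply/bigcupP; exists i.
Qed.

(** Otherwise the V i and W would be four disjoint sparse sets. *)
Lemma rest_not_sparse : (forall i, sparse (V i)) -> ~~ sparse W.
Proof.
move=> sV; apply/negP => sW.
pose i0 : 'I_3 := ord0; pose i1 : 'I_3 := Ordinal (isT : 1 < 3).
pose i2 : 'I_3 := ord_max.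
by apply: (@four_sparse (V i0) (V i1) (V i2) W); do ?split; rewrite ?Vn0 ?Vdisj ?VW ?sV.
Qed.

(** If kappa <= k, the V i are sparse, hence W is not.  But at most 3 k edges
    leave W: this is less than d, so |W| > d, and then W is sparse after all. *)
Lemma kappa_gt : k < kappa.
Proof.
rewrite ltnNge; apply/negP => le_kk.
have sV i : sparse (V i).
  by apply: sparse_low; rewrite ?Vn0 // /bd Vkappa; nia.
have := rest_not_sparse sV; rewrite /sparse -ltnNge => ltW.
have [leWd|ltdW] := leqP #|W| d; first by have := leq_trans (dense_small Vcover leWd) boundaryW; lia.
have : 9 * C * d.+1 < 6 * kappa * d * d.+1 by nia.
by rewrite ltn_mul2r /=; nia.
Qed.

Section PartitionBound.
Variable P : {set {set T}}.
Hypotheses (partP : partition P setT) (P_gt1 : 1 < #|P|).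

Let trivP : trivIset P. Proof. by case/and3P: partP. Qed.
Let P_n0 : set0 \notin P. Proof. by case/and3P: partP. Qed.

Let block_n0 U : U \in P -> U != set0.
Proof. by move=> UP; apply: contraNneq P_n0 => <-. Qed.

Let block_disj U U' : U \in P -> U' \in P -> U != U' -> [disjoint U & U'].
Proof. exact: (trivIsetP trivP). Qed.

Let block_nT U : U \in P -> U != setT.
Proof.
move=> UP; apply: contraTneq P_gt1 => UT; rewrite -leqNgt (cardD1 U) UP add1n ltnS.
rewrite leqn0; apply/eqP/eq_card0 => U'; rewrite !inE.
apply/negP => /andP[U'U U'P]; have := block_disj U'P UP U'U.
by case/set0Pn: (block_n0 U'P) => x xU' /disjointFr/(_ xU'); rewrite UT inE.
Qed.

Let kappa_block U : U \in P -> kappa <= bd U.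
Proof. by move=> UP; apply: le_kappa; [exact: block_n0 | exact: block_nT]. Qed.

Let lt_block U : U \in P -> C < d * bd U.
Proof. by move/kappa_block; have := kappa_gt; nia. Qed.

Let card_dense : #|P| <= #|[set U in P | ~~ sparse U]| + 3.
Proof.
rewrite -(cardsID [set U | sparse U] P) addnC leq_add //.
  by apply: subset_leq_card; apply/subsetP => U; rewrite !inE andbC.
apply: leq_trans (card_sparse_le trivP P_n0); apply: subset_leq_card.
by apply/subsetP => U; rewrite !inE andbC.
Qed.

(** Every block has more than c boundary edges and every block that is not
    sparse more than 3 c.  With at most three sparse blocks the total exceeds
    p c + 2 c (p - 3), which is at least 2 c (p - 1) for p >= 4; for p = 2 the
    first bound suffices. *)
Let many_blocks : #|P| != 3 -> 2 * C * (#|P| - 1) < d * \sum_(U in P) bd U.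
Proof.
move=> P_n3; set D := [set U in P | ~~ sparse U].
have DP : D \subset P by apply/subsetP => U; rewrite inE => /andP[].
suff : C.+1 * #|P| + 2 * C * #|D| <= d * \sum_(U in P) bd U.
  by have := card_dense; rewrite -/D; nia.
have -> : #|D| = \sum_(U in P) ~~ sparse U.
  rewrite -sum1_card [RHS]big_mkcond [LHS]big_mkcond; apply: eq_bigr => U _.
  by rewrite inE; case: (U \in P) => //; case: sparse.
rewrite mulnC -sum_nat_const !big_distrr -big_split; apply: leq_sum => U UP /=.
have := lt_block UP; have := boundary_not_sparse (block_n0 UP).
by rewrite -/(bd U); case: sparse => /= [_|/(_ isT)]; lia.
Qed.

(** Three blocks whose boundaries sum to at most 4 c.  Each boundary is then at
    most 4 c - 2 kappa < 2 c, so all blocks are sparse, and kappa <= 4 c / 3, so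
    all V i are sparse as well. *)
Section ThreeBlocks.
Hypothesis P3 : #|P| = 3.
Hypothesis low : d * \sum_(U in P) bd U <= 4 * C.

Let kappa_others U : U \in P -> bd U + 2 * kappa <= \sum_(U' in P) bd U'.
Proof.
move=> UP; rewrite (big_setD1 U UP) /= leq_add2l.
have -> : 2 = #|P :\ U| by have := cardsD1 U P; rewrite UP P3 => -[].
rewrite -sum_nat_const; apply: leq_sum => U'; rewrite inE => /andP[_].
exact: kappa_block.
Qed.

Let block_low U : U \in P -> d * bd U <= 2 * C.
Proof. by move=> /kappa_others; have := kappa_gt; move: low; nia. Qed.

Let block_sparse U : U \in P -> sparse U.
Proof. by move=> UP; apply: sparse_low; [exact: block_n0 | exact: block_low]. Qed.

Let kappa_low : 3 * (d * kappa) <= 4 * C.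
Proof.
have [U UP] : exists U, U \in P by apply/card_gt0P; rewrite P3.
have := kappa_others UP; have := kappa_block UP; move: low; nia.
Qed.

Let sparseV i : sparse (V i).
Proof. by apply: sparse_low; rewrite ?Vn0 // /bd Vkappa; move: kappa_low; lia. Qed.

(** W is not sparse, but at most 3 kappa <= 4 c edges leave it: this bounds |W|
    by d - 1.  If 2 <= |W| <= d - 1, then |W| (d + 1 - |W|) >= 2 (d - 1) edges
    leave W, which is more than 4 c. *)
Let W1 : #|W| = 1.
Proof.
have W_gt0 : 0 < #|W| by rewrite card_gt0.
have nsW := rest_not_sparse sparseV.
have ltW : #|W| < d.
  move: nsW; rewrite /sparse -ltnNge => ltW.
  have : 9 * #|W| < 8 * d.+1 by move: boundaryW kappa_low ltW; nia.
  by lia.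
have := boundary_degree W eirr le_d; rewrite -/(bd W) => leW.
have lt3k : 3 * kappa < 4 * (k + 1).
  rewrite -(ltn_pmul2l (m := d)); first by move: kappa_low; nia.
  by lia.
apply/eqP; rewrite eqn_leq W_gt0 andbT leqNgt; apply/negP => W_gt1.
have : 2 * d.-1 <= bd W by nia.
by move: boundaryW; lia.
Qed.

Let other_two (j : 'I_3) : exists l m : 'I_3, [/\ l != j, m != j & l != m].
Proof.
exists (j + 1)%R, (j + 2)%R.
by case: j => -[|[|[|]]].
Qed.

Let other_blocks U : U \in P ->
  exists U1 U2, [/\ U1 \in P, U2 \in P, U1 != U, U2 != U & U1 != U2].
Proof.
move=> UP; have : 1 < #|P :\ U| by have := cardsD1 U P; rewrite UP P3 add1n => -[<-].
case/card_gt1P => U1 [U2 []]; rewrite !inE => /andP[? ?] /andP[? ?] ?.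
by exists U1, U2.
Qed.

(** If V j and U covered everything, the other two V i would lie in U and the
    other two blocks in V j, giving four disjoint sparse sets. *)
Let cover_neq j U : U \in P -> V j :|: U != setT.
Proof.
move=> UP; apply/eqP => VU.
have [l [m [lj mj lm]]] := other_two j.
have [U1 [U2 [U1P U2P U1U U2U U12]]] := other_blocks UP.
have VsubU i : i != j -> V i \subset U.
  move=> ij; apply/subsetP => x xi; have : x \in V j :|: U by rewrite VU inE.
  by rewrite inE (disjointFr (Vdisj ij) xi).
have dU i U' : i != j -> U' \in P -> U' != U -> [disjoint V i & U'].
  move=> ij U'P U'U; apply: disjointWl (VsubU i ij) _.
  by apply: block_disj; rewrite // eq_sym.
apply: (@four_sparse (V l) (V m) U1 U2); do ?split; rewrite ?Vn0 ?Vdisj ?sparseV //;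
  by [exact: block_n0 | exact: dU | exact: block_disj | exact: block_sparse].
Qed.

(** Submodularity: since V j and U do not cover everything, their union has at
    least kappa boundary edges, so their intersection has at most as many as
    U. *)
Let cell_sparse j U : U \in P -> V j :&: U != set0 -> sparse (V j :&: U).
Proof.
move=> UP VU0; apply: sparse_low => //; apply: leq_trans (block_low UP).
rewrite leq_mul2l; apply/orP; right.
have := boundary_submod e (V j) U; have := le_kappa _ (cover_neq j UP).
rewrite Vkappa /bd => le_k; suff : V j :|: U != set0 by move/le_k; lia.
by apply: contraNneq (block_n0 UP) => U0; rewrite -subset0 -U0 subsetUr.
Qed.

(** A V j meeting two blocks would contain two disjoint sparse cells, to be
    completed by the other two V i. *)
Let V_in_block j U : U \in P -> V j :&: U != set0 -> V j \subset U.
Proof.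
move=> UP VU0; apply/subsetPn => -[x xj xU].
have [l [m [lj mj lm]]] := other_two j.
have xP : x \in cover P by rewrite (cover_partition partP) inE.
set U' := pblock P x; have U'P : U' \in P by exact: pblock_mem.
have xU' : x \in U' by rewrite mem_pblock.
have U'U : U != U' by apply: contraNneq xU => ->.
have VU'0 : V j :&: U' != set0 by apply/set0Pn; exists x; rewrite inE xj.
have dV i Y : i != j -> [disjoint V j :&: Y & V i].
  by move=> ij; apply: disjointWl (subsetIl _ _) _; apply: Vdisj; rewrite eq_sym.
apply: (@four_sparse (V j :&: U) (V j :&: U') (V l) (V m)); do ?split;
  rewrite ?Vn0 ?Vdisj ?sparseV ?dV ?cell_sparse //.
exact/(disjointWl (subsetIr _ _))/(disjointWr (subsetIr _ _))/block_disj.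
Qed.

(** Each V j lies in one block, and each block contains some V j because no
    block is reduced to the single vertex v of W, whose degree is too large.
    So blocks and V j correspond one to one, and one block is V j with v added;
    then d <= deg v <= kappa + bd (block), which makes the sum of the boundaries
    at least d + kappa >= 4 (k + 1) > 4 c. *)
Lemma three_blocks_absurd : False.
Proof.
have [v Wv] : exists v, W = [set v] by apply/cards1P/eqP/W1.
have bd_v : d <= bd [set v].
  by apply: dense_small; [exact/set0Pn/(ex_intro _ v)/set11 | rewrite cards1; lia].
have /fin_all_exists[x xV] (j : 'I_3) : exists x, x \in V j.
  exact/set0Pn/Vn0.
pose s j := pblock P (x j).
have coverP y : y \in cover P by rewrite (cover_partition partP) inE.
have sP j : s j \in P by exact: pblock_mem.
have Vs j : V j \subset s j.
  by apply: V_in_block => //; apply/set0Pn; exists (x j); rewrite inE xV mem_pblock coverP.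
have sE j y U : U \in P -> y \in U -> y \in V j -> s j = U.
  move=> UP yU yj; apply: contraTeq yU => sU.
  by rewrite (disjointFr (block_disj (sP j) UP sU)) // (subsetP (Vs j)).
have Vor y : y != v -> exists j, y \in V j.
  move=> yv; have : y \notin W by rewrite Wv inE.
  by rewrite inE negbK => /bigcupP[j _]; exists j.
have P_img : P = s @: setT.
  apply/eqP; rewrite eqEsubset andbC; apply/andP; split.
    by apply/subsetP => _ /imsetP[j _ ->].
  apply/subsetP => U UP; have : ~~ (U \subset [set v]).
    apply: contraL (block_low UP); rewrite subset1 (negPf (block_n0 UP)) orbF => /eqP->.
    by rewrite -ltnNge; nia.
  case/subsetPn => y yU; rewrite inE => /Vor[j yj].
  by rewrite -(sE j y U UP yU yj) imset_f.
have s_inj : injective s.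
  suff inj : {in setT &, injective s} by move=> i j; apply: inj; rewrite inE.
  by apply/imset_injP; rewrite -P_img P3 cardsT card_ord.
have [j sj] : exists j, s j = pblock P v.
  have : pblock P v \in P by exact: pblock_mem.
  by rewrite {2}P_img => /imsetP[j _ ->]; exists j.
have v_sj : v \in s j by rewrite sj mem_pblock coverP.
have sjV : s j :\: V j = [set v].
  apply/setP => y; rewrite !inE; have [->|/Vor[i yi]] := eqVneq y v.
    by rewrite v_sj (disjointFl (VW j)) // -/W Wv set11.
  apply/andP => -[yj ysj]; case/negP: yj.
  by rewrite -(s_inj _ _ (sE i y _ (sP j) ysj yi)).
have := boundary_setD esym (s j) (V j); rewrite sjV Vkappa => le_v.
have := kappa_others (sP j); have := kappa_gt; move: low le_v bd_v; rewrite /bd; nia.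
Qed.

End ThreeBlocks.

Lemma partition_boundary : 2 * C * (#|P| - 1) < d * \sum_(U in P) bd U.
Proof.
have [P3|] := eqVneq #|P| 3; last exact: many_blocks.
by rewrite ltnNge P3; apply/negP => le_sum; apply: three_blocks_absurd => //; lia.
Qed.

End PartitionBound.
End Partitions.

(** * Forests *)

Lemma connect_ind (T : finType) (r : rel T) (P : T -> Prop) x y :
  P x -> (forall u v, connect r x u -> P u -> r u v -> P v) -> connect r x y -> P y.
Proof.
move=> Px IH /connectP[p]; elim/last_ind: p y => [|p z IHp] y /=; first by move=> _ ->.
rewrite rcons_path last_rcons => /andP[xp pz] ->.
by apply: IH pz; [apply/connectP; exists p | exact: IHp].
Qed.

Section Forests.
Variable T : finType.
Implicit Types (A B E F G S : {set {set T}}) (f g : {set T}) (x y u v a b : T).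

Lemma adj_subrel A B : A \subset B -> subrel (adj A) (adj B).
Proof. by move=> /subsetP AB x y /andP[xy /AB]; rewrite /adj xy. Qed.

Lemma connect_adjS A B x y : A \subset B -> connect (adj A) x y -> connect (adj B) x y.
Proof.
move=> /adj_subrel AB; apply: connect_sub => u v /AB; exact: connect1.
Qed.

(** A walk using the added edge can be assumed to use it once, in one of the two
    directions. *)
Lemma connect_adjU1 F x y u v : connect (adj ([set x; y] |: F)) u v ->
  [\/ connect (adj F) u v, connect (adj F) u x /\ connect (adj F) y v
    | connect (adj F) u y /\ connect (adj F) x v].
Proof.
pose Q v := [\/ connect (adj F) u v, connect (adj F) u x /\ connect (adj F) y v
  | connect (adj F) u y /\ connect (adj F) x v].
apply: (connect_ind (P := Q)); first by constructor 1.
rewrite {}/Q => {}v w _ IH /andP[vw]; rewrite !inE => /orP[/eqP/eq_set2[][? ?]|vwF].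
- subst v w; case: IH => [uv|[uv _]|[uv _]]; [constructor 2|constructor 2|constructor 1] => //.
- subst v w; case: IH => [uv|[uv _]|[uv _]]; [constructor 3|constructor 1|constructor 3] => //.
have {vwF}vw1 : connect (adj F) v w by apply: connect1; rewrite /adj vw.
case: IH => [uv|[uv1 uv2]|[uv1 uv2]]; [constructor 1|constructor 2|constructor 3].
- exact: connect_trans vw1.
- by split=> //; apply: connect_trans vw1.
- by split=> //; apply: connect_trans vw1.
Qed.

(** Forests are handled through the property that every edge is a bridge, which
    is what the deletion and the addition of edges interact with. *)
Definition bridged F : bool :=
  [forall x, forall y, adj F x y ==> ~~ connect (adj (F :\ [set x; y])) x y].

Lemma bridgedP F : reflect
  (forall x y, adj F x y -> ~~ connect (adj (F :\ [set x; y])) x y) (bridged F).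
Proof.
apply: (iffP forallP) => [brF x y|brF x]; first by have /forallP/(_ y)/implyP := brF x.
by apply/forallP => y; apply/implyP; exact: brF.
Qed.

Lemma bridgedS A B : A \subset B -> bridged B -> bridged A.
Proof.
move=> AB /bridgedP brB; apply/bridgedP => x y /(adj_subrel AB)/brB.
by apply: contra; apply: connect_adjS; exact: setSD.
Qed.

Lemma bridged0 : bridged set0.
Proof. by apply/bridgedP => x y; rewrite /adj inE andbF. Qed.

(** If an old edge ab stopped being a bridge, the new connection from a to b
    would run through xy, and closing it up with ab would connect x to y in
    F. *)
Lemma bridgedU1 F x y :
  bridged F -> ~~ connect (adj F) x y -> bridged ([set x; y] |: F).
Proof.
move=> /bridgedP brF Nxy; apply/bridgedP => a b /andP[ab].
rewrite !inE => /orP[/eqP abE|abF].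
  apply: contra Nxy => con; have {}con : connect (adj F) a b.
    by apply: connect_adjS con; rewrite abE subDset.
  by case: (eq_set2 abE) con => -[-> ->] //; rewrite adj_connect_sym.
have /brF Nab : adj F a b by rewrite /adj ab.
apply: contra Nxy => con.
have {}con : connect (adj ([set x; y] |: (F :\ [set a; b]))) a b.
  by apply: connect_adjS con; rewrite setDUl setSU // subsetDl.
have up u v : connect (adj (F :\ [set a; b])) u v -> connect (adj F) u v.
  by apply: connect_adjS; exact: subsetDl.
have ab1 : connect (adj F) a b by apply: connect1; rewrite /adj ab.
have ba1 : connect (adj F) b a by rewrite adj_connect_sym.
case: (connect_adjU1 con) => [ab2|[ax yb]|[ay xb]]; first by rewrite ab2 in Nab.
  move/up: ax; rewrite adj_connect_sym => /connect_trans; apply.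
  by apply: connect_trans ab1 _; rewrite adj_connect_sym up.
by apply: connect_trans (up _ _ xb) (connect_trans ba1 (up _ _ ay)).
Qed.

(** A cycle minus its first edge still connects the ends of that edge. *)
Lemma bridged_acyclic F : bridged F -> acyclic F.
Proof.
move=> /bridgedP brF [|x [|y c]] // c_gt2 /andP[/= /andP[xy pc] /and3P[xc yc _]].
have /negP[] := brF x y xy; rewrite adj_connect_sym.
apply/connectP; exists (rcons c x); last by rewrite last_rcons.
case: c c_gt2 xc yc pc => // z c _; rewrite !inE => /norP[xy' /norP[xz xc]] /norP[yz yc].
rewrite /= => /andP[yz1 pc]; apply/andP; split.
  case/andP: yz1 => yz1 yzF; rewrite /adj yz1 !inE yzF andbT.
  by apply: contraNneq xz => /eq_set2[[yx _]|[_ ->]] //; rewrite yx eqxx in xy'.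
have {yc}: y \notin z :: c by rewrite inE negb_or yz.
elim: c z {yz1 yz xz} xc pc => [|w c IHc] z /= xc.
  rewrite inE => /andP[zx _] yz; rewrite andbT.
  case/andP: zx => zx zxF; rewrite /adj zx !inE zxF andbT.
  by apply: contraNneq yz => /eq_set2[[zx' _]|[-> _]] //; rewrite zx' eqxx in zx.
move=> /andP[zw pc]; rewrite inE negb_or => /andP[yz ywc].
move: xc; rewrite inE negb_or => /andP[xw xc].
rewrite IHc // andbT; case/andP: zw => zw zwF; rewrite /adj zw !inE zwF andbT.
apply: contraNneq yz => /eq_set2[[_ wy]|[-> _]] //.
by rewrite wy inE eqxx in ywc.
Qed.

Definition components F : {set {set T}} := [set component F x | x : T].

Lemma mem_component F x y : (y \in component F x) = connect (adj F) x y.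
Proof. by rewrite inE. Qed.

Lemma component_eq F x y :
  (component F x == component F y) = connect (adj F) x y.
Proof.
apply/eqP/idP => [/setP/(_ y)|xy]; first by rewrite !mem_component connect0.
by apply/setP => z; rewrite !mem_component; apply: same_connect => //; exact: adj_connect_sym.
Qed.

Lemma eq_components F G : (forall x y, connect (adj F) x y = connect (adj G) x y) ->
  components F = components G.
Proof.
by move=> eqFG; apply: eq_imset => x; apply/setP => y; rewrite !mem_component eqFG.
Qed.

Lemma components_partition F : partition (components F) setT.
Proof.
apply/and3P; split.
- rewrite eqEsubset subsetT; apply/subsetP => x _; apply/bigcupP.
  by exists (component F x); rewrite ?imset_f ?mem_component.
- apply/trivIsetP => _ _ /imsetP[x _ ->] /imsetP[y _ ->]; apply: contraR.
  rewrite -setI_eq0 => /set0Pn[z]; rewrite inE !mem_component => /andP[xz yz].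
  by rewrite component_eq (connect_trans xz) // adj_connect_sym.
- by apply/negP => /imsetP[x _ /setP/(_ x)]; rewrite inE mem_component connect0.
Qed.

Lemma card_components_gt0 F (x : T) : 0 < #|components F|.
Proof. by apply/card_gt0P; exists (component F x); rewrite imset_f. Qed.

Lemma connected_components F : (connected F) = (#|components F| <= 1).
Proof.
apply/forallP/idP => [con|le1 x].
  rewrite leqNgt; apply/negP => /card_gt1P[_ [_ [/imsetP[x _ ->] /imsetP[y _ ->]]]].
  by rewrite component_eq; have /forallP-> := con x.
apply/forallP => y; rewrite -component_eq; apply/eqP.
by apply: (card_le1_eqP le1); rewrite imset_f.
Qed.

Lemma card_componentsU1 F x y : ~~ connect (adj F) x y ->
  #|components F| = #|components ([set x; y] |: F)|.+1.
Proof.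
move=> Nxy; set G := _ |: F.
have FG : F \subset G by exact: subsetUr.
have xyG : connect (adj G) x y.
  apply: connect1; rewrite /adj !inE eqxx andbT.
  by apply: contraNneq Nxy => ->.
have compG z : component G z = if connect (adj F) x z || connect (adj F) y z
    then component G x else component F z.
  case: ifPn => [xyz|/norP[xz yz]].
    apply/eqP; rewrite component_eq adj_connect_sym.
    case/orP: xyz => /(connect_adjS FG) //; exact: connect_trans.
  apply/setP => w; rewrite !mem_component; apply/idP/idP; last exact: connect_adjS.
  case/connect_adjU1 => // -[]; rewrite adj_connect_sym => zz; first by rewrite zz in xz.
  by rewrite zz in yz.
have -> : components G = component G x |: (components F :\ component F x :\ component F y).
  apply/setP => U; rewrite !inE; apply/imsetP/idP => [[z _ ->]|].
    rewrite compG; case: ifPn => [_|/norP[xz yz]]; first by rewrite eqxx.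
    rewrite ![component F z == _]eq_sym !component_eq xz yz imset_f ?orbT //.
  case/orP => [/eqP->|/and3P[yU xU /imsetP[z _ Uz]]]; first by exists x.
  exists z => //; rewrite compG; case: ifPn => //.
  by rewrite -!component_eq -Uz ![_ == U]eq_sym (negPf yU) (negPf xU).
set D := _ :\ component F y; have notD : component G x \notin D.
  rewrite !inE; apply/negP => /and3P[_ xz /imsetP[z _ Gz]].
  have : x \in component G x by rewrite mem_component.
  rewrite Gz mem_component -component_eq => /eqP zx.
  by rewrite Gz zx eqxx in xz.
rewrite cardsU1 notD (cardsD1 (component F x)) imset_f //.
rewrite (cardsD1 (component F y)) -/D !inE imset_f // andbT.
by rewrite eq_sym component_eq Nxy.
Qed.

Lemma bridged_card F : (forall f, f \in F -> #|f| = 2) -> bridged F ->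
  #|F| + #|components F| = #|T|.
Proof.
have [m] := ubnP #|F|; elim: m F => // m IHm F ltFm simF brF.
have [F0|[f fF]] := set_0Vmem F.
  rewrite F0 cards0 /components card_imset // => x y /eqP; rewrite component_eq.
  case/connectP => -[|z p] /=; first by move=> _ ->.
  by rewrite /adj inE andbF.
have /eqP/cards2P[x [y [xy fE]]] := simF f fF.
have Nxy : ~~ connect (adj (F :\ f)) x y.
  by rewrite fE; apply: (bridgedP _ brF); rewrite /adj xy -fE.
have := card_componentsU1 Nxy; rewrite -fE setD1K // => cardC.
have := cardsD1 f F; rewrite fF add1n => cardF.
rewrite cardF addSn -addnS -cardC; apply: IHm.
- by rewrite -ltnS -cardF.
- by move=> g; rewrite inE => /andP[_ /simF].
- by apply: bridgedS brF; exact: subsetDl.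
Qed.

(** An edge set S minimal among those connecting x to y is the path of F from x
    to y; in a forest, removing any of its edges disconnects x from y. *)
Lemma minimal_connect F x y :
  (forall f, f \in F -> #|f| = 2) -> bridged F -> connect (adj F) x y ->
  exists S, [/\ S \subset F, connect (adj S) x y
    & forall f, f \in S -> ~~ connect (adj (F :\ f)) x y].
Proof.
move=> simF brF conF; pose p S := connect (adj S) x y.
have [S /minsetP[conS minS] SF] := minset_exists (P := p) conF.
exists S; split=> // f fS; apply/negP => conFf.
have NSf : ~~ connect (adj (S :\ f)) x y.
  apply/negP => /minS/(_ (subsetDl _ _))/setP/(_ f).
  by rewrite !inE eqxx fS.
have /eqP/cards2P[a [b [ab fE]]] := simF f (subsetP SF f fS).
have /negP[] : ~~ connect (adj (F :\ f)) a b.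
  by rewrite fE; apply: (bridgedP _ brF); rewrite /adj ab -fE (subsetP SF).
have up u v : connect (adj (S :\ f)) u v -> connect (adj (F :\ f)) u v.
  by apply: connect_adjS; exact: setSD.
have yx : connect (adj (F :\ f)) y x by rewrite adj_connect_sym.
move: conS; rewrite /p -(setD1K fS) {1}fE => /connect_adjU1[xy|[xa b_y]|[xb ay]].
- by rewrite xy in NSf.
- rewrite adj_connect_sym; apply: connect_trans (up _ _ b_y) _.
  exact: connect_trans yx (up _ _ xa).
- apply: connect_trans (up _ _ ay) _; exact: connect_trans yx (up _ _ xb).
Qed.

End Forests.

(** * Maximal packings of forests *)

Section Packings.
Variables (T I : finType) (E : {set {set T}}).
Hypothesis simE : forall f, f \in E -> #|f| = 2.
Implicit Types (Fs Gs Hs : {ffun I -> {set {set T}}}) (f g : {set T}) (i j : I).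

Definition packing Fs : bool :=
  [forall i, (Fs i \subset E) && bridged (Fs i)]
  && [forall i, forall j, (i != j) ==> [disjoint Fs i & Fs j]].

Lemma packingP Fs : reflect
  [/\ forall i, Fs i \subset E, forall i, bridged (Fs i)
    & forall i j, i != j -> [disjoint Fs i & Fs j]] (packing Fs).
Proof.
apply: (iffP andP) => [[/forallP FE /forallP Fd]|[FE Fb Fd]]; split.
- by move=> i; case/andP: (FE i).
- by move=> i; case/andP: (FE i).
- by move=> i j; have /forallP/(_ j)/implyP := Fd i.
- by apply/forallP => i; rewrite FE Fb.
- by apply/forallP => i; apply/forallP => j; apply/implyP; exact: Fd.
Qed.

Definition covered Fs : {set {set T}} := \bigcup_i Fs i.

(** Maximality in the product order on sizes rather than for the total size:
    a maximal packing can then be taken above a given one, so that forests that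
    are already spanning trees remain so. *)
Definition maximal Fs : Prop := forall Gs, packing Gs ->
  (forall i, #|Fs i| <= #|Gs i|) -> forall i, #|Gs i| <= #|Fs i|.

Lemma exists_maximal Fs : packing Fs ->
  exists Gs, [/\ packing Gs, forall i, #|Fs i| <= #|Gs i| & maximal Gs].
Proof.
move=> packF; pose p Gs := packing Gs && [forall i, #|Fs i| <= #|Gs i|].
have pF : p Fs by rewrite /p packF; apply/forallP => i.
case: (arg_maxnP (fun Gs => \sum_i #|Gs i|) pF) => Gs /andP[packG /forallP leFG] maxG.
exists Gs; split=> // Hs packH leGH i.
have pH : p Hs by rewrite /p packH; apply/forallP => j; exact: leq_trans (leGH j).
have sumE (F : {ffun I -> {set {set T}}}) :
  \sum_j #|F j| = #|F i| + \sum_(j | j != i) #|F j| by rewrite (bigD1 i).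
have /= := maxG Hs pH; rewrite !sumE => le_sum.
rewrite -(leq_add2r (\sum_(j | j != i) #|Hs j|)) (leq_trans le_sum) // leq_add2l.
by apply: leq_sum => j _; exact: leGH.
Qed.

Definition replace Fs i (F : {set {set T}}) : {ffun I -> {set {set T}}} :=
  [ffun j => if j == i then F else Fs j].

Lemma packing_replace Fs i f (F : {set {set T}}) : packing Fs -> f \in E -> f \notin covered Fs ->
  F \subset f |: Fs i -> bridged F -> packing (replace Fs i F).
Proof.
move=> /packingP[FE Fb Fd] fE fNF FS bF.
have FsE : f |: Fs i \subset E by rewrite subUset sub1set fE FE.
have dF j : j != i -> [disjoint F & Fs j].
  move=> ji; apply: disjointWl FS _; rewrite disjoint_subset; apply/subsetP => g.
  rewrite !inE => /orP[/eqP->|gi]; last by rewrite (disjointFr (Fd i j _) gi) // eq_sym.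
  by apply: contra fNF => fj; apply/bigcupP; exists j.
apply/packingP; split=> [j|j|j l]; rewrite !ffunE.
- by case: eqP => // _; exact: subset_trans FS FsE.
- by case: eqP.
- move=> jl; case: (eqVneq j i) => [ji|ji]; case: (eqVneq l i) => [li|li].
  + by rewrite ji li eqxx in jl.
  + exact: dF.
  + by rewrite disjoint_sym dF.
  + exact: Fd.
Qed.

(** An uncovered edge f enters one of the forests and an edge g leaves it; since
    sizes do not change, maximality is preserved. *)
Definition exchange Fs Gs : bool := packing Gs &&
  [exists i, exists f in E, exists g in Fs i,
     (f \notin covered Fs) && (Gs == replace Fs i (f |: Fs i :\ g))].

Lemma exchangeP Fs Gs : reflect (packing Gs /\ exists i f g,
    [/\ f \in E, g \in Fs i, f \notin covered Fs
      & Gs = replace Fs i (f |: Fs i :\ g)]) (exchange Fs Gs).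
Proof.
apply: (iffP andP) => [[packG /existsP[i /exists_inP[f fE /exists_inP[g gF]]]]|].
  by move=> /andP[fN /eqP GE]; split=> //; exists i, f, g.
case=> packG [i [f [g [fE gF fN GE]]]]; split=> //; apply/existsP; exists i.
by apply/exists_inP; exists f => //; apply/exists_inP; exists g; rewrite // fN GE eqxx.
Qed.

Lemma card_exchange Fs Gs i : exchange Fs Gs -> #|Gs i| = #|Fs i|.
Proof.
case/exchangeP => _ [j [f [g [fE gF fN ->]]]]; rewrite ffunE.
have [->|//] := eqVneq i j; rewrite cardsU1 [in RHS](cardsD1 g) gF !inE.
suff /negPf-> : f \notin Fs j by rewrite andbF.
by apply: contra fN => fj; apply/bigcupP; exists j.
Qed.

Section MaximalPacking.
Variable Fs : {ffun I -> {set {set T}}}.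
Hypotheses (packF : packing Fs) (maxF : maximal Fs).

Let reach Gs := connect exchange Fs Gs.

Lemma reach_packing Gs : reach Gs -> packing Gs.
Proof. by apply: (connect_ind (P := packing)) => // Gs' Hs _ _ /andP[]. Qed.

Lemma reach_card Gs : reach Gs -> forall i, #|Gs i| = #|Fs i|.
Proof.
apply: (connect_ind (P := fun Gs => forall i, #|Gs i| = #|Fs i|)) => // Gs' Hs _ IH ex i.
by rewrite (card_exchange i ex).
Qed.

Lemma reach_spans Gs i x y : reach Gs -> [set x; y] \in E ->
  [set x; y] \notin covered Gs -> connect (adj (Gs i)) x y.
Proof.
move=> reG fE fN; apply: contraT => Nxy; have packG := reach_packing reG.
have /packingP[_ bG _] := packG.
have := packing_replace packG fE fN (subxx _) (bridgedU1 (bG i) Nxy).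
move=> /maxF/(_ _ i); rewrite ffunE eqxx cardsU1 -(reach_card reG).
have -> : [set x; y] \notin Gs i by apply: contra fN => fj; apply/bigcupP; exists i.
rewrite ltnn; apply => j; rewrite ffunE -(reach_card reG).
by case: eqP => // ->; apply: subset_leq_card; exact: subsetUr.
Qed.

(** The edges that some sequence of exchanges leaves uncovered. *)
Definition exchangeable : {set {set T}} :=
  [set f in E | [exists Gs, reach Gs && (f \notin covered Gs)]].
Local Notation A := exchangeable.

Lemma uncovered_exchangeable Gs f : reach Gs -> f \in E -> f \notin covered Gs -> f \in A.
Proof. by move=> reG fE fN; rewrite inE fE; apply/existsP; exists Gs; rewrite reG. Qed.

(** Any edge of the path joining x to y in the i-th forest can be exchanged
    against xy, hence is itself exchangeable. *)
Lemma uncovered_spanned Gs i x y : reach Gs -> [set x; y] \in E ->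
  [set x; y] \notin covered Gs -> connect (adj (Gs i :&: A)) x y.
Proof.
move=> reG fE fN; have packG := reach_packing reG.
have /packingP[GE bG dG] := packG.
have simG f : f \in Gs i -> #|f| = 2 by move/(subsetP (GE i))/simE.
have [S [SG conS sepS]] := minimal_connect simG (bG i) (reach_spans i reG fE fN).
apply: connect_adjS conS; rewrite subsetI SG; apply/subsetP => g gS.
have gG := subsetP SG g gS; have gE := subsetP (GE i) g gG.
have gf : g != [set x; y].
  by apply: contraNneq fN => <-; apply/bigcupP; exists i.
have packH : packing (replace Gs i ([set x; y] |: Gs i :\ g)).
  apply: packing_replace packG fE fN _ _.
    by rewrite setUS // subsetDl.
  by apply: bridgedU1 (sepS g gS); apply: bridgedS (bG i); exact: subsetDl.
apply: (uncovered_exchangeable (Gs := replace Gs i ([set x; y] |: Gs i :\ g))) => //.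
  apply: connect_trans reG (connect1 _); apply/exchangeP; split=> //.
  by exists i, [set x; y], g.
apply/negP => /bigcupP[j _]; rewrite ffunE; have [_|ji] := eqVneq j i.
  by rewrite !inE eqxx (negPf gf).
by rewrite (disjointFl (dG j i ji) gG).
Qed.

(** Going back along the exchanges: an edge f brought in by an exchange has its
    ends connected, through exchangeable edges, in the forest it entered. *)
Lemma reach_spanned Gs i x y : reach Gs ->
  connect (adj (Gs i :&: A)) x y -> connect (adj (Fs i :&: A)) x y.
Proof.
move=> reG; move: reG x y; apply: (connect_ind (P := fun Gs => forall x y,
  connect (adj (Gs i :&: A)) x y -> connect (adj (Fs i :&: A)) x y)) => //.
move=> {}Gs Hs reG IH /exchangeP[packH [j [f [g [fE gF fN HE]]]]] x y conH.
apply: IH; move: conH; rewrite HE ffunE; case: eqVneq => [ij|//].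
subst j; apply: connect_sub => u v /andP[uv]; rewrite !inE => /andP[/orP[/eqP uvf|/andP[_ uvG]] uvA].
  by apply: uncovered_spanned; rewrite ?uvf.
by apply: connect1; rewrite /adj uv !inE uvG.
Qed.

(** The nontrivial half of the matroid union theorem for graphic matroids: the
    restriction of every forest to A spans A, and edges outside A are all
    used. *)
Theorem maximal_packing : exists2 A : {set {set T}},
  E :\: A \subset covered Fs &
  forall i x y, [set x; y] \in A -> connect (adj (Fs i :&: A)) x y.
Proof.
exists A.
- apply/subsetP => f; rewrite inE => /andP[fA fE]; apply: contraR fA.
  exact: uncovered_exchangeable (connect0 _ _) fE.
- move=> i x y; rewrite inE => /andP[fE /existsP[Gs /andP[reG fN]]].
  exact: reach_spanned reG (uncovered_spanned i reG fE fN).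
Qed.

End MaximalPacking.

(** In each forest, the edges of A form a spanning forest of A, of size |T| minus
    the number of components of A; the other edges of the forests cover the
    complement of A. *)
Lemma packing_count Fs (A : {set {set T}}) : packing Fs ->
  E :\: A \subset covered Fs ->
  (forall i x y, [set x; y] \in A -> connect (adj (Fs i :&: A)) x y) ->
  #|I| * #|T| + #|E :\: A| <= \sum_i #|Fs i| + #|I| * #|components A|.
Proof.
move=> /packingP[FE bF _] cov span.
have compF i : components (Fs i :&: A) = components A.
  apply: eq_components => x y; apply/idP/idP; first exact/connect_adjS/subsetIr.
  by apply: connect_sub => u v /andP[_]; exact: span.
have cardF i : #|T| + #|Fs i :\: A| = #|Fs i| + #|components A|.
  rewrite -(cardsID A (Fs i)) addnAC -(compF i) bridged_card //.
    by move=> f; rewrite inE => /andP[/(subsetP (FE i))/simE].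
  by apply: bridgedS (bF i); exact: subsetIl.
have := eq_bigr _ (fun i (_ : true) => cardF i).
move/(_ 0 addn (index_enum I)); rewrite !big_split /= !sum_nat_const => <-.
rewrite leq_add2l; apply: leq_trans (_ : #|\bigcup_i (Fs i :\: A)| <= _).
  apply: subset_leq_card; apply/subsetP => f fEA.
  have /bigcupP[i _ fi] := subsetP cov f fEA; apply/bigcupP; exists i => //.
  by move: fEA; rewrite !inE fi => /andP[->].
elim/big_rec2: _ => [|i n X _ le_n]; first by rewrite cards0.
by rewrite (leq_trans (leq_card_setU _ _)) // leq_add2l.
Qed.

End Packings.

(** * From partitions to spanning trees and a large forest *)

Section Assembly.
Variables (T : finType) (e : rel T) (k d : nat).
Hypothesis eirr : irreflexive e.
Implicit Types (F A : {set {set T}}) (X U : {set T}) (x y : T).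

Lemma card_edge f : f \in edges e -> #|f| = 2.
Proof.
case/imset2P => x y _; rewrite inE => /andP[_ xy] ->; rewrite cards2.
by case: eqP xy => // ->; rewrite eirr.
Qed.

(** An edge leaving a component of A is not in A, and it leaves only the
    components of its two ends. *)
Lemma sum_boundary_components A :
  \sum_(U in components A) boundary e U <= 2 * #|edges e :\: A|.
Proof.
pose cut U := [set [set x; y] | x in U, y in ~: U & e x y].
have cut_le U : U \in components A -> boundary e U <= \sum_(f in edges e :\: A) (f \in cut U).
  case/imsetP => z _ ->; rewrite -edges_between_boundary //.
  rewrite /edges_between -/(cut _) -sum1_card big_mkcond [leqRHS]big_mkcond; apply: leq_sum => f _ /=.
  case: ifP => // fcut; suff -> : f \in edges e :\: A by [].
  case/imset2P: fcut => x y xz; rewrite !inE => /andP[yz xy] ->.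
  apply/andP; split; last by apply/imset2P; exists x y; rewrite ?inE.
  apply: contra yz => xyA; rewrite mem_component in xz *.
  apply: connect_trans xz (connect1 _); rewrite /adj xyA andbT.
  by apply: contraTneq xy => ->; rewrite eirr.
apply: leq_trans (leq_sum _ cut_le) _; rewrite exchange_big mulnC -sum_nat_const /=.
apply: leq_sum => f; rewrite inE => /andP[_ /imset2P[x y _ _ ->]].
have -> : \sum_(U in components A) ([set x; y] \in cut U)
    = #|[set U in components A | [set x; y] \in cut U]|.
  rewrite -sum1_card big_mkcond [RHS]big_mkcond; apply: eq_bigr => U _.
  by rewrite inE; case: (U \in _) => //; case: (_ \in cut U).
apply: leq_trans (_ : #|[set component A x; component A y]| <= 2).
  apply: subset_leq_card; apply/subsetP => U; rewrite inE.
  case/andP => /imsetP[z _ ->] /imset2P[u v uz _] /eq_set2 uv.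
  have : (x \in component A z) || (y \in component A z).
    by case: uv => -[-> ->]; rewrite uz ?orbT.
  by rewrite !mem_component -!component_eq !inE.
by rewrite cards2; case: (_ != _).
Qed.

(** The edges inside the component of x form a forest with one component on that
    vertex set and at most one more for each vertex outside. *)
Lemma card_component_edges F x : F \subset edges e -> bridged F ->
  #|component F x| <= #|component_edges F x|.+1.
Proof.
move=> FE bF; set F' := component_edges F x; set X := component F x.
have F'F : F' \subset F by apply/subsetP => f; rewrite inE => /andP[].
have := bridged_card _ (bridgedS F'F bF).
move=> /(_ (fun f fF' => card_edge (subsetP FE f (subsetP F'F f fF')))) cardF'.
have XF' y : y \in X -> component F' y = component F' x.
  move=> yX; apply/eqP; rewrite component_eq adj_connect_sym.
  move: yX; rewrite mem_component; apply: (connect_ind (P := fun y => connect (adj F') x y)) => //.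
  move=> u v xu xu' /[dup] uv1 /andP[uv uvF]; apply: connect_trans xu' (connect1 _).
  rewrite /adj uv inE uvF; apply/subsetP => w; rewrite !inE.
  by case/orP => /eqP-> //; apply: connect_trans xu (connect1 _).
have : #|components F'| <= (#|~: X|).+1.
  apply: leq_trans (_ : #|component F' x |: (component F' @: ~: X)| <= _).
    apply: subset_leq_card; apply/subsetP => _ /imsetP[y _ ->]; rewrite in_setU1.
    have [yX|yX] := boolP (y \in X); first by rewrite XF' ?eqxx.
    by apply/orP; right; apply: imset_f; rewrite in_setC.
  by rewrite cardsU1 -[in leqRHS]add1n leq_add ?leq_imset_card ?leq_b1.
have := cardsC X; rewrite -cardF'; lia.
Qed.

Hypotheses (d_gt0 : 0 < d) (d_ge : 3 * k + 3 <= d) (T_gt1 : 1 < #|T|).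
Hypothesis low_boundary : forall X, X != set0 -> #|X| <= d -> d <= boundary e X.
Hypothesis partition_large : forall P : {set {set T}}, partition P setT -> 1 < #|P| ->
  2 * (k * d + d.-1) * (#|P| - 1) < d * \sum_(U in P) boundary e U.

Let E := edges e.

Let T0 : T := enum_val (Ordinal (ltnW T_gt1)).

Let crossing_large A : 1 < #|components A| ->
  (k * d + d.-1) * (#|components A| - 1) < d * #|E :\: A|.
Proof.
move=> p_gt1; have large := partition_large (components_partition A) p_gt1.
rewrite -(ltn_pmul2l (m := 2)) // mulnA [in ltnRHS]mulnCA; apply: leq_trans large _.
by rewrite leq_mul2l sum_boundary_components orbT.
Qed.

Let tree_card F : F \subset E -> bridged F -> #|F| <= #|T|.-1.
Proof.
move=> FE bF; have := bridged_card (fun f fF => card_edge (subsetP FE f fF)) bF.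
by have := card_components_gt0 F T0; lia.
Qed.

Let spanning_of_card F : F \subset E -> bridged F -> #|T|.-1 <= #|F| -> spanning_tree e F.
Proof.
move=> FE bF leF; split; first by split=> //; exact: bridged_acyclic.
rewrite connected_components.
by have := bridged_card (fun f fF => card_edge (subsetP FE f fF)) bF; lia.
Qed.

(** A maximal packing of k forests has at least
    k (n - p) + crossing >= k (n - 1) edges, where p is the number of components
    of A and crossing counts the edges outside A; no forest has more than
    n - 1. *)
Lemma spanning_tree_packing : exists Ts : {ffun 'I_k -> {set {set T}}},
  packing E Ts /\ forall i, #|T|.-1 <= #|Ts i|.
Proof.
have pack0 : packing E [ffun _ : 'I_k => set0].
  apply/packingP; split=> [i|i|i j _]; rewrite !ffunE ?sub0set ?bridged0 //.
  by rewrite -setI_eq0 set0I.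
have [Ts [packT _ maxT]] := exists_maximal pack0.
have [A cov span] := maximal_packing card_edge packT maxT.
have := packing_count card_edge packT cov span; rewrite card_ord => count.
exists Ts; split=> // i; have /packingP[TE bT _] := packT.
have sum_le : k * #|T|.-1 <= \sum_j #|Ts j|.
  have p_gt0 := card_components_gt0 A T0.
  have [p1|p_gt1] := leqP #|components A| 1; first by nia.
  have : k * (#|components A| - 1) <= #|E :\: A|.
    rewrite -(leq_pmul2l d_gt0); have := crossing_large p_gt1; nia.
  by move: count T_gt1; rewrite -/E; nia.
rewrite leqNgt; apply/negP => lt_i.
move: sum_le; rewrite leqNgt => /negP; apply.
have -> : k * #|T|.-1 = \sum_(j < k) #|T|.-1 by rewrite sum_nat_const card_ord.
rewrite (bigD1 i) //= [in ltnRHS](bigD1 i) //=.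
rewrite -addSn leq_add //; apply: leq_sum => j _; exact: tree_card.
Qed.

(** The k spanning trees together with an empty forest are extended to a maximal
    packing of k + 1 forests; the trees cannot grow, so F receives all the
    remaining edges of the count. *)
Theorem property_P_of_partitions : property_P k d e.
Proof.
have [Ts [packT leT]] := spanning_tree_packing.
have /packingP[TE bT dT] := packT.
(* The index None stands for the additional forest. *)
pose Fs : {ffun option 'I_k -> {set {set T}}} :=
  [ffun o => if o is Some i then Ts i else set0].
have packF : packing E Fs.
  apply/packingP; split=> [[i|]|[i|]|[i|] [j|]]; rewrite !ffunE ?sub0set ?bridged0 //.
  - by move=> ij; apply: dT; apply: contra_neq ij => ->.
  - by rewrite -setI_eq0 setI0.
  - by rewrite -setI_eq0 set0I.
have [Gs [packG leG maxG]] := exists_maximal packF.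
have /packingP[GE bG dG] := packG.
have [A cov span] := maximal_packing card_edge packG maxG.
have := packing_count card_edge packG cov span; rewrite card_option card_ord.
set F := Gs None; set p := #|components A|; set a := #|E :\: A| => count.
have p_gt0 : 0 < p by exact: card_components_gt0 T0.
have p_le : p <= #|T| by exact: leq_imset_card.
have sum_le : \sum_o #|Gs o| <= #|F| + k * #|T|.-1.
  rewrite (bigD1 None) //= leq_add2l.
  have -> : k * #|T|.-1 = \sum_(o : option 'I_k | o != None) #|T|.-1.
    by rewrite sum_nat_const (cardC1 None) card_option card_ord.
  by apply: leq_sum => o _; exact: tree_card.
have sizeF : #|T|.-1 + a <= #|F| + k.+1 * p.-1 by nia.
have spanF : #|T|.-1 <= #|F| -> spanning_tree e F := spanning_of_card (GE None) (bG None).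
exists (fun i => Gs (Some i)); split=> [i|i j ij|].
- apply: spanning_of_card (GE _) (bG _) _; apply: leq_trans (leT i) _.
  by have := leG (Some i); rewrite ffunE.
- by apply: dG; apply: contra_neq ij => -[].
exists F; split=> [|i||NspanF].
- by split; [exact: GE | exact/bridged_acyclic/bG].
- exact: dG.
- have ltF : d.-1 * #|T|.-1 < #|F| * d.
    have [p1|p_gt1] := leqP p 1; first by nia.
    by have := crossing_large p_gt1; rewrite -/p -/a; nia.
  rewrite mulrAC ltr_pdivrMr ?ltr0n // -[1%R]/(1%:R)%R -!natrB ?(ltnW T_gt1) //.
  by rewrite -!natrM ltr_nat !subn1.
(* If every component of A has at most d vertices, then a >= p d / 2. *)
have [x ltx] : exists x, d < #|component A x|.
  apply/existsP; apply: contraT => /existsPn small; case: NspanF; apply: spanF.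
  have [p1|p_gt1] := leqP p 1; first by nia.
  have : p * d <= 2 * a.
    apply: leq_trans (sum_boundary_components A); rewrite /p -sum_nat_const.
    apply: leq_sum => _ /imsetP[x _ ->]; apply: low_boundary; last by rewrite leqNgt.
    by apply/set0Pn; exists x; rewrite mem_component.
  by nia.
exists x; rewrite -ltnS; apply: leq_trans (card_component_edges x (GE None) (bG None)).
apply: leq_trans ltx _; apply: subset_leq_card; apply/subsetP => y.
rewrite !mem_component => conA; apply: connect_adjS (subsetIl F A) _.
by apply: connect_sub conA => u v /andP[_]; exact: span.
Qed.

End Assembly.

Local Open Scope ring_scope.

(** * The spectral criterion *)

Lemma min_degree_le (T : finType) (e : rel T) x : (min_degree e <= degree e x)%N.
Proof.
rewrite /min_degree; have := mem_index_enum x.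
elim: (index_enum T) => // y s IHs; rewrite inE big_cons geq_min.
by case/orP => [/eqP->|/IHs->]; rewrite ?leqnn ?orbT.
Qed.

Lemma sparse_ratio (R : realType) (T : finType) (e : rel T) (k d : nat) (X : {set T}) :
  (0 < d)%N -> sparse e k d X ->
  2 * (boundary e X)%:R <= 9 * (k%:R + (d%:R - 1) / d%:R) / (d%:R + 1) * #|X|%:R :> R.
Proof.
move=> d_gt0; rewrite /sparse -(ler_nat R) !natrM natrD natrM -subn1 natrB //.
rewrite -[d.+1]addn1 natrD => sp; have dR : 0 < d%:R :> R by rewrite ltr0n.
have dR1 : 0 < d%:R + 1 :> R by rewrite addr_gt0.
rewrite -(ler_pM2l (mulr_gt0 dR dR1)).
have -> : d%:R * (d%:R + 1) * (9 * (k%:R + (d%:R - 1) / d%:R) / (d%:R + 1) * #|X|%:R)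
   = 9 * (k%:R * d%:R + (d%:R - 1)) * #|X|%:R :> R.
  by field; rewrite !gt_eqF.
by apply: le_trans sp; rewrite le_eqVlt; apply/orP; left; apply/eqP; ring.
Qed.

Theorem corollary4p2 (R : realType) (a b : R)
    (ha : -1 <= a) (hb : b != 0) (hab : -1 <= a / b)
    (k : nat) (hk : (2 <= k)%N)
    (T : finType) (e : rel T) (esym : symmetric e) (eirr : irreflexive e)
    (hG : in_Gt 2 e)
    (n : nat) (hn : #|T| = n)
    (delta : nat) (hdelta : min_degree e = delta)
    (hdk : (3 * k + 3 <= delta)%N)
    (hlambda :
      [\/ lambda_a e 4 a <
            (a + 1) * delta%:R
            - 9 * (k%:R + (delta%:R - 1) / delta%:R) / (delta%:R + 1),
          0 < b /\
          lambda_ab e 4 a b <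
            (a + b) * delta%:R
            - 9 * b * (k%:R + (delta%:R - 1) / delta%:R) / (delta%:R + 1)
        | b < 0 /\
          (a + b) * delta%:R
            - 9 * b * (k%:R + (delta%:R - 1) / delta%:R) / (delta%:R + 1)
            < lambda_ab e (n - 3) a b]) :
  property_P k delta e.
Proof.
have [V [Vproper Vdisj Vcover Vkappa]] := hG.
have Vn0 i : V i != set0 by case: (Vproper i).
have le_d x : (delta <= degree e x)%N by rewrite -hdelta min_degree_le.
have d_gt0 : (0 < delta)%N by lia.
have few : forall X : 'I_4 -> {set T}, (forall i, X i != set0) ->
    (forall i j, i != j -> [disjoint X i & X j]) ->
    exists i, ~~ sparse e k delta (X i).
  move=> X Xn0 Xdisj; apply/existsP; apply: contraT => /existsPn allsp.
  pose q : R := 9 * (k%:R + (delta%:R - 1) / delta%:R) / (delta%:R + 1).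
  have le_q i : 2 * (boundary e (X i))%:R <= q * #|X i|%:R.
    by apply: sparse_ratio => //; rewrite -[sparse _ _ _ _]negbK.
  have qE : 9 * b * (k%:R + (delta%:R - 1) / delta%:R) / (delta%:R + 1) = b * q.
    by rewrite /q; ring.
  case: hlambda; rewrite ?qE.
  - have := lambda_ab_ge (a := a) (b := 1) esym (isT : 0 < 4)%N Xdisj Xn0 le_d le_q.
    rewrite /lambda_ab /lambda_a scale1r mul1r -/q => ge_t lt_t.
    by have := lt_le_trans lt_t (ge_t _ ler01); rewrite ltxx; apply; lra.
  - move=> [b_gt0 lt_t].
    have ab_ge0 : 0 <= a + b by move: hab; rewrite ler_pdivlMr //; lra.
    have := lambda_ab_ge esym (isT : 0 < 4)%N Xdisj Xn0 le_d le_q ab_ge0 (ltW b_gt0).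
    by rewrite leNgt lt_t.
  - move=> [b_lt0]; rewrite -hn => lt_t.
    have ab_le0 : a + b <= 0 by move: hab; rewrite ler_ndivlMr //; lra.
    have := lambda_ab_le esym (isT : 0 < 4)%N Xdisj Xn0 le_d le_q ab_le0 (ltW b_lt0).
    by rewrite leNgt lt_t.
have Vk i : boundary e (V i) = edge_connectivity e.
  by rewrite -edges_between_boundary.
have large := partition_boundary esym eirr le_d (edge_connectivity_le esym)
  Vn0 Vdisj Vcover Vk hk hdk few.
apply: (property_P_of_partitions eirr d_gt0 hdk _ _ large); last first.
  by move=> X; exact: boundary_small.
have /set0Pn[x _] := Vn0 ord0.
have : (degree e x < #|T|)%N.
  rewrite -cardsT; apply: proper_card; rewrite properT.
  by apply: contraTneq (in_setT x) => <-; rewrite inE eirr.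
by have := le_d x; lia.
Qed.
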